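(* For every positive integer $n$, $$\operatorname{M}(TAD_{2n-1})=2^{n^2}\cdot\frac{(2n-1)!!}{n!}\cdot\prod_{i=1}^{2n-1}\frac{(2i)!}{(n+i)!},$$ $$\operatorname{M}(TAD_{2n})=2^{n(n+1)}\cdot\prod_{i=0}^{n-1}\frac{(4i+2)!\,(4i+3)!}{(n+2i+1)!\,(n+2i+2)!},$$ $$\operatorname{M}(TAD'_{2n-1})=2^{n^2-1}\cdot\prod_{i=0}^{n-1}\frac{(4i+2)!}{(n+2i+1)!}\cdot\prod_{i=0}^{n-2}\frac{(4i+3)!}{(n+2i+1)!},$$ $$\operatorname{M}(TAD'_{2n})=2^{n(n+1)}\cdot\frac{(2n+1)!!}{(n+1)!}\cdot\prod_{i=0}^{n-1}\frac{(4i+2)!\,(4i+4)!}{(n+2i+1)!\,(n+2i+3)!}.$$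
   Context: $\operatorname{M}(R)$ denotes the number of domino tilings of a region $R$ on the square lattice. Empty products equal $1$, and $(2m-1)!!=(2m-1)(2m-3)\cdots 1$. The Aztec diamond $AD_k$ is the union of all unit squares $[i,i+1]\times[j,j+1]$ ($i,j\in\mathbb Z$) whose centers $(x,y)$ satisfy $|x|+|y|\le k$. Truncated Aztec diamonds: $TAD_{2n-1}$ is the union of the unit squares of $AD_{2n-1}$ contained in $\{(x,y): x\ge -n,\ y\ge -n\}$; $TAD_{2n}$ is the union of the unit squares of $AD_{2n}$ contained in $\{x\ge -n,\ y\ge -n\}$; $TAD'_{2n-1}$ is the union of the unit squares of $AD_{2n-1}$ contained in $\{x\ge -n,\ y\ge -n+1\}$; $TAD'_{2n}$ is the union of the unit squares of $AD_{2n}$ contained in $\{x\ge -n-1,\ y\ge -n\}$. *)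

(* Defs.v *)
From HB Require Import structures.
From mathcomp Require Import all_boot all_order all_algebra.
From mathcomp Require Import finmap.
From mathcomp Require Import zify lra.

Set Implicit Arguments.
Unset Strict Implicit.
Unset Printing Implicit Defensive.

Import Order.TTheory GRing.Theory Num.Theory.
Local Open Scope fset_scope.
Local Open Scope ring_scope.

(* The cell (i, j) stands for the closed unit square [i, i+1] x [j, j+1]. *)
Notation cell := (int * int)%type.
Notation region := {fset cell}.

Definition center (c : cell) : rat * rat :=
  (c.1%:~R + 2%:R^-1, c.2%:~R + 2%:R^-1).

(* The two squares have exactly one edge in common. *)
Definition adjacent (c d : cell) : bool :=
  `|c.1 - d.1| + `|c.2 - d.2| == 1.

Definition is_domino (R : region) (D : {set R}) : bool :=
  [exists c : R, exists d : R,
    adjacent (fsval c) (fsval d) && (D == [set c; d]%SET)].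

Definition is_tiling (R : region) (P : {set {set R}}) : bool :=
  partition P [set: R]%SET && [forall D in P, is_domino D].

Definition M (R : region) : nat := #|[set P : {set {set R}} | is_tiling P]%SET|.

(* Any square whose center satisfies |x| + |y| <= k has coordinates i and j
   in [-k, k]; the box only serves to make the set finite, see in_AD. *)
Definition box (k : nat) : region :=
  [fset c : cell in
    [seq ((a : nat)%:Z - k%:Z, (b : nat)%:Z - k%:Z)
       | a <- iota 0 (2 * k).+1, b <- iota 0 (2 * k).+1]].

Definition AD (k : nat) : region :=
  [fset c in box k | `|(center c).1| + `|(center c).2| <= k%:R].

Lemma in_box (k : nat) (c : cell) : (c \in box k) = (`|c.1| <= k%:Z) && (`|c.2| <= k%:Z).
Proof.
rewrite in_fset; apply/allpairsP/andP => [[[a b] []]|[]].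
  by rewrite !mem_iota => /= ha hb ->; move: ha hb => /=; lia.
case: c => i j /= hi hj; exists (absz (i + k%:Z), absz (j + k%:Z)).
have aux (m : int) : `|m| <= k%:Z -> absz (m + k%:Z) \in iota 0 (2 * k).+1.
  by rewrite mem_iota; lia.
by split; [exact: aux | exact: aux | congr pair => /=; lia].
Qed.

Lemma in_AD (k : nat) (c : cell) :
  (c \in AD k) = (`|(center c).1| + `|(center c).2| <= k%:R).
Proof.
rewrite in_fset inE /= andb_idl // in_box.
case: c => i j /= h.
have aux (m : int) : `|m%:~R + 2%:R^-1 : rat| <= k%:R -> `|m| <= k%:Z.
  rewrite ler_norml => /andP[h1 h2].
  have : (- k%:Z - 1)%:~R < m%:~R :> rat by rewrite rmorphB rmorphN /=; lra.
  have : m%:~R < k%:Z%:~R :> rat by move: h2; rewrite -pmulrn; lra.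
  by rewrite !ltr_int; lia.
by apply/andP; split; apply: aux; apply: le_trans h;
  rewrite ?lerDl ?lerDr normr_ge0.
Qed.

(* [i, i+1] x [j, j+1] is contained in {x >= a, y >= b} iff a <= i and b <= j. *)
Definition truncate (R : region) (a b : int) : region :=
  [fset c in R | (a <= c.1) && (b <= c.2)].

(* uphalf (2n-1) = uphalf (2n) = n, see TAD_odd, TAD_even, TAD'_odd and
   TAD'_even for the four families of regions. *)
Definition TAD (k : nat) : region :=
  let n : int := (uphalf k)%:Z in truncate (AD k) (- n) (- n).

Definition TAD' (k : nat) : region :=
  let n : int := (uphalf k)%:Z in
  if odd k then truncate (AD k) (- n) (- n + 1)
  else truncate (AD k) (- n - 1) (- n).

Lemma TAD_odd n : (0 < n)%N ->
  TAD (2 * n - 1) = truncate (AD (2 * n - 1)) (- n%:Z) (- n%:Z).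
Proof. by move=> n0; rewrite /TAD; have -> : uphalf (2 * n - 1) = n by lia. Qed.

Lemma TAD_even n : TAD (2 * n) = truncate (AD (2 * n)) (- n%:Z) (- n%:Z).
Proof. by rewrite /TAD; have -> : uphalf (2 * n) = n by lia. Qed.

Lemma TAD'_odd n : (0 < n)%N ->
  TAD' (2 * n - 1) = truncate (AD (2 * n - 1)) (- n%:Z) (- n%:Z + 1).
Proof.
move=> n0; rewrite /TAD'; have -> : odd (2 * n - 1) by lia.
by have -> : uphalf (2 * n - 1) = n by lia.
Qed.

Lemma TAD'_even n :
  TAD' (2 * n) = truncate (AD (2 * n)) (- n%:Z - 1) (- n%:Z).
Proof.
rewrite /TAD'; have -> : odd (2 * n) = false by lia.
by have -> : uphalf (2 * n) = n by lia.
Qed.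

Fixpoint dfact (n : nat) : nat := if n is m.+2 then (n * dfact m)%N else 1%N.

(* Main.v *)
Require Import Defs.
From mathcomp Require Import all_boot all_order all_fingroup all_algebra.
From mathcomp Require Import finmap.
From mathcomp Require Import zify ring lra.

(**
Sweeping a truncated diamond column by column turns a tiling into a family of
non-intersecting particle trajectories, and the number of tilings into the
determinant of the numbers [y^(2(a+j)+e+1)] w^(2i+e+1), i, j < b, where
w (1 - y^2) = y (1 + w^2), for the truncation at x >= -a, y >= -b of the diamond
of order k = a + b + e - 1.  When the sweep passes a step of the lower right
boundary, the bottom particle leaves and the rows are divided by w/y; this series
is even in y, so that the division is a unitriangular column operation.

These numbers are the pairings mu (U_(2i+e) F_(2(a+j)+e)), where U_h are the
Chebyshev polynomials, orthonormal for the functional mu whose moments are the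
Catalan numbers, and F_h(x) = i^(-h) U_h(ix) are orthogonal for the mirrored
functional.  Up to unitriangular factors the determinant is that of the moments
of both functionals stacked on top of each other.  As the mirrored moments
differ only by signs (-1)^(i+j), the even and odd columns separate when a - b is
0 or 1, leaving 2^b det(Cat_(i+2j+e))_(i,j<a) det(Cat_(i+2j+1+e))_(i,j<b).

Finally Cat_(i+x) is, up to a factor depending on x only, a polynomial of degree
n - 1 in x, so det(Cat_(i+x_j))_(i,j<n) is a Vandermonde determinant up to a
constant, which is read off from the Hankel determinant det(Cat_(i+j)) = 1.
*)

Set Implicit Arguments.
Unset Strict Implicit.
Unset Printing Implicit Defensive.

Import Order.TTheory GRing.Theory Num.Theory.

(** * Perfect matchings and their expansion at a vertex *)

Section PerfectMatchings.
Local Open Scope set_scope.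
Variables (T : finType) (e : rel T).
Hypothesis e_sym : symmetric e.
Hypothesis e_irr : irreflexive e.

Definition edge (D : {set T}) : bool :=
  [exists c, exists d, e c d && (D == [set c; d])].

Definition matchings (A : {set T}) : {set {set {set T}}} :=
  [set P | partition P A && [forall D in P, edge D]].

Lemma edge_mem c D : edge D -> c \in D -> exists2 d, e c d & D = [set c; d].
Proof.
case/existsP=> a /existsP[b /andP[eab /eqP->]]; rewrite !inE => /orP[]/eqP->.
  by exists b.
by exists a; rewrite 1?e_sym // setUC.
Qed.

Lemma edge_neq0 D : edge D -> D != set0.
Proof.
by case/existsP=> a /existsP[b /andP[_ /eqP->]]; apply/set0Pn; exists a; rewrite !inE eqxx.
Qed.

Lemma card_matchings0 : #|matchings set0| = 1%N.
Proof.
rewrite (_ : matchings set0 = [set set0]) ?cards1 //.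
apply/setP=> P; rewrite !inE partition_set0; case: eqP => //= ->.
by apply/forall_inP => D; rewrite inE.
Qed.

Lemma card_matchings_edge (A : {set T}) c d : c \in A -> d \in A -> e c d ->
  #|[set P in matchings A | [set c; d] \in P]| = #|matchings (A :\: [set c; d])|.
Proof.
move=> cA dA ecd; have cd_edge : edge [set c; d].
  by apply/existsP; exists c; apply/existsP; exists d; rewrite ecd /=.
have cdA : [set c; d] \subset A by apply/subsetP => x; rewrite !inE => /orP[]/eqP->.
rewrite -(@card_in_imset _ _ (fun P : {set {set T}} => [set c; d] |: P)
  (matchings (A :\: [set c; d]))); last first.
  have nP P : P \in matchings (A :\: [set c; d]) -> [set c; d] \notin P.
    rewrite inE => /andP[pP _]; apply/negP => /(partitionS pP)/subsetP/(_ c).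
    by rewrite !inE eqxx /= => /(_ isT).
  move=> P Q /nP nP' /nP nQ' E.
  by rewrite -(setU1K nP') E setU1K.
congr #|pred_of_set _|; apply/setP => P; rewrite !inE; apply/idP/imsetP.
  case/andP=> /andP[pP /forall_inP dP] cdP; exists (P :\ [set c; d]); last by rewrite setD1K.
  rewrite inE partitionD1 //=; apply/forall_inP => D; rewrite !inE => /andP[_]; exact: dP.
case=> Q; rewrite inE => /andP[pQ /forall_inP dQ] ->.
have A_E : A = [set c; d] :|: A :\: [set c; d] by rewrite -{1}(setID A [set c; d]) (setIidPr cdA).
rewrite setU11 andbT {1}A_E partitionU1 ?edge_neq0 //=.
  by apply/forall_inP => D; rewrite !inE => /orP[/eqP->//|]; exact: dQ.
by rewrite -setI_eq0; apply/eqP/setP => x; rewrite !inE; case: (_ || _).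
Qed.

(** Every perfect matching covers [c] by exactly one edge, so the matchings are sorted by the
    partner of [c]. *)
Lemma card_matchings_rec (A : {set T}) c : c \in A ->
  #|matchings A| = (\sum_(d in A | e c d) #|matchings (A :\: [set c; d])|)%N.
Proof.
move=> cA; transitivity (\sum_(d in A | e c d)
    #|[set P in matchings A | [set c; d] \in P]|)%N; last first.
  by apply: eq_bigr => d /andP[dA ecd]; rewrite card_matchings_edge.
under eq_bigr do rewrite -sum1dep_card big_mkcondr.
rewrite exchange_big -sum1_card; apply: eq_bigr => P PA.
have /andP[pP /forall_inP dP] : partition P A && [forall D in P, edge D].
  by move: PA; rewrite inE.
have cB : c \in cover P by rewrite (cover_partition pP).
have [d ecd def] := edge_mem (dP _ (pblock_mem cB)) (etrans (mem_pblock P c) cB).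
have cdP : [set c; d] \in P by rewrite -def pblock_mem.
have dA : d \in A by apply: (subsetP (partitionS pP cdP)); rewrite !inE eqxx orbT.
rewrite (bigD1 d) ?dA //= cdP big1 // => x /andP[/andP[xA ecx] xd].
case: ifP => // cxP.
have tP := partition_trivIset pP.
have E : [set c; d] = [set c; x].
  by rewrite -(def_pblock tP cdP (x := c)) ?(def_pblock tP cxP) ?inE ?eqxx.
have : x \in [set c; d] by rewrite E !inE eqxx orbT.
by rewrite !inE (negbTE xd) orbF => /eqP xc; move: ecx; rewrite xc e_irr.
Qed.

End PerfectMatchings.

(** * Matchings swept column by column *)

(* The entries of a mask are the cells of a column, from bottom to top; [true]
   marks a cell that is already covered from the left.  The masks in [fills m]
   mark the cells from which a horizontal domino leaves to the right. *)
Fixpoint fills (m : seq bool) : seq (seq bool) :=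
  match m with
  | [::] => [:: [::]]
  | true :: m1 => map (cons false) (fills m1)
  | false :: m1 => map (cons true) (fills m1) ++
      (if m1 is false :: m2 then map (fun c => [:: false, false & c]) (fills m2) else [::])
  end.

Lemma seq2_ind (A : Type) (P : seq A -> Prop) : P [::] -> (forall x, P [:: x]) ->
  (forall x y s, P s -> P (y :: s) -> P [:: x, y & s]) -> forall s, P s.
Proof.
move=> P0 P1 P2 s; have [] : P s /\ (forall x, P (x :: s)); last by [].
by elim: s => [|x s [IH1 IH2]]; split=> // y; apply: P2.
Qed.

Lemma size_fills m : all (fun c => size c == size m) (fills m).
Proof.
elim/seq2_ind: m => [//|[]//|[] y m IH1 IH2] /=.
  by rewrite all_map; apply: sub_all IH2 => c /=.
rewrite all_cat all_map; apply/andP; split; first by apply: sub_all IH2 => c /=.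
by case: y {IH2} => //=; rewrite all_map; apply: sub_all IH1 => c /=.
Qed.

(** [g] holds the heights of the free cells of the next column, and entry [i] of [c] refers to
    height [Y + i]. *)
Definition remaining (g : pred nat) (Y : nat) (c : seq bool) : pred nat :=
  fun h => g h && ~~ ((Y <= h) && nth false c (h - Y)).

Definition allowed (g : pred nat) (Y : nat) (c : seq bool) : bool :=
  all (fun i => nth false c i ==> g (Y + i)) (iota 0 (size c)).

Lemma allowed_cons g Y b c : allowed g Y (b :: c) = (b ==> g Y) && allowed g Y.+1 c.
Proof.
rewrite /allowed /= addn0; congr andb.
rewrite -[1%N]/(1 + 0)%N iotaDl all_map; apply: eq_all => i /=.
by rewrite addnS.
Qed.

Section ColumnSweep.
Variables (T : finType) (e : rel T) (pos : T -> nat * nat) (D : pred (nat * nat)).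
Hypothesis pos_inj : injective pos.
Hypothesis posP : forall z, reflect (exists c, pos c = z) (D z).

Definition grid_adj (z w : nat * nat) : bool :=
  (z.1 - w.1) + (w.1 - z.1) + ((z.2 - w.2) + (w.2 - z.2)) == 1.

Hypothesis eE : forall c d, e c d = grid_adj (pos c) (pos d).

Definition match_count (p : pred (nat * nat)) := #|matchings e [set c | p (pos c)]%SET|.

Lemma e_sym : symmetric e.
Proof. by move=> c d; rewrite !eE /grid_adj; lia. Qed.

Lemma e_irr : irreflexive e.
Proof. by move=> c; rewrite !eE /grid_adj; lia. Qed.

Lemma eq_match_count (p q : pred (nat * nat)) : (forall z, D z -> p z = q z) -> match_count p = match_count q.
Proof.
move=> pq; congr #|pred_of_set (matchings _ _)|; apply/setP => c; rewrite !inE.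
by apply/pq/posP; exists c.
Qed.

Definition remove2 (p : pred (nat * nat)) z w : pred (nat * nat) :=
  fun v => [&& p v, v != z & v != w].

(** In the order of the sweep the cells to the left of and below [z] are already gone, so that the
    domino of [z] points right or up. *)
Lemma match_count_rec (p : pred (nat * nat)) z (r := (z.1.+1, z.2)) (u := (z.1, z.2.+1)) :
  D z -> p z -> (forall w, D w -> p w -> grid_adj z w -> (w == r) || (w == u)) ->
  match_count p = ((if D r && p r then match_count (remove2 p z r) else 0) +
          (if D u && p u then match_count (remove2 p z u) else 0))%N.
Proof.
move=> /posP[c pc] pz ph.
have cA : c \in [set c | p (pos c)]%SET by rewrite inE pc.
rewrite /match_count (card_matchings_rec e_sym e_irr cA).
have ru : r != u by rewrite /r /u xpair_eqE; lia.
have one w : grid_adj z w ->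
   (\sum_(d in [set c | p (pos c)]%SET | e c d && (pos d == w))
     #|matchings e ([set c | p (pos c)] :\: [set c; d])%SET|)%N =
   (if D w && p w then match_count (remove2 p z w) else 0)%N.
  move=> zw; case: posP => [[d pd]|nD]; last first.
    by rewrite big1 // => d /and3P[_ _ /eqP pd]; case: nD; exists d.
  rewrite /=; case: ifP => pw; last first.
    by rewrite big1 // => d' /and3P[]; rewrite inE => h _ /eqP E; move: h; rewrite E pw.
  rewrite (bigD1 d) ?inE /=; last by rewrite eE pc pd pw zw eqxx.
  rewrite big1 ?addn0; last first.
    move=> d' /andP[/and3P[_ _ /eqP E] /eqP]; case; apply: pos_inj; congruence.
  congr #|pred_of_set (matchings _ _)|; apply/setP => x; rewrite !inE /remove2 -pc -pd.
  by rewrite !(inj_eq pos_inj) negb_or andbC.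
rewrite (bigID (fun d => pos d == r)) /=.
congr addn; rewrite -one; try by rewrite /grid_adj /r /u /=; lia.
  by apply: eq_bigl => d; rewrite andbA.
apply: eq_bigl => d; rewrite -andbA; case: (boolP (d \in _)) => //=; rewrite inE => pd.
case: (boolP (e c d)) => //= ecd.
have Dd : D (pos d) by apply/posP; exists d.
have := ph _ Dd pd; rewrite -pc -eE => /(_ ecd) /orP[]/eqP->; rewrite !eqxx //=.
  by rewrite (negbTE ru).
by rewrite eq_sym ru.
Qed.

Lemma match_count_empty (p : pred (nat * nat)) : (forall z, D z -> ~~ p z) -> match_count p = 1%N.
Proof.
move=> np; rewrite -(card_matchings0 e); congr #|pred_of_set (matchings _ _)|.
by apply/setP => c; rewrite !inE; apply/negbTE/np/posP; exists c.
Qed.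

(** The default [true] makes all cells beyond the end of the mask count as covered. Column [X.+1] is
    described separately by [g], since dominoes may already have entered it. *)
Definition front (X Y : nat) (m : seq bool) (g : pred nat) : pred (nat * nat) :=
  fun z => if z.1 == X then (Y <= z.2) && ~~ nth true m (z.2 - Y)
           else if z.1 == X.+1 then g z.2 else (X < z.1) && D z.

(** The lowest cell of the mask is treated first, and the recursion of [fills] records the choice
    between right and up. An upward domino uses two entries, hence the induction on a bound for the
    length. *)
Lemma match_count_front X Y m (g : pred nat) :
  (forall i, ~~ nth true m i -> D (X, Y + i)) -> (forall h, g h -> D (X.+1, h)) ->
  match_count (front X Y m g) =
  (\sum_(c <- fills m) if allowed g Y c then match_count (front X 0 [::] (remaining g Y c)) else 0)%N.
Proof.
have [n] := ubnP (size m); elim: n m Y g => // n IH [|x m] Y g /= sm Dm Dg.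
  rewrite big_seq1 /allowed /=; apply: eq_match_count => z _; rewrite /front /remaining.
  by rewrite !nth_nil /= !andbF; case: ifP => // _; case: ifP; rewrite // andbT.
have remS b c h : remaining g Y (b :: c) h = remaining (fun h => g h && ~~ (b && (h == Y))) Y.+1 c h.
  rewrite /remaining; case: (ltngtP Y h) => h2 /=; rewrite ?andbF ?andbT //.
    by rewrite (_ : h - Y = (h - Y.+1).+1)%N //; lia.
  by rewrite h2 subnn ?eqxx ?andbT /= ?andbT.
have front_rem m' g1 g2 : g1 =1 g2 -> match_count (front X 0 m' g1) = match_count (front X 0 m' g2).
  by move=> E; apply: eq_match_count => z _; rewrite /front E.
have Dm1 i : ~~ nth true m i -> D (X, Y.+1 + i) by move/(Dm i.+1); rewrite addnS.
case: x Dm => Dm.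
  rewrite big_map (_ : match_count _ = match_count (front X Y.+1 m g)); last first.
    apply: eq_match_count => z _; rewrite /front; case: ifP => // _.
    case: (ltngtP Y z.2) => h //=; last by rewrite h subnn.
    by rewrite (_ : z.2 - Y = (z.2 - Y.+1).+1)%N //; lia.
  rewrite IH //; apply: eq_bigr => c _; rewrite allowed_cons /=; case: ifP => // _.
  by apply: front_rem => h; rewrite remS /remaining andbT.
rewrite (@match_count_rec _ (X, Y)) /=; first last.
- move=> [w1 w2] _; rewrite /front /grid_adj !xpair_eqE /=.
  case: eqP => [->|w1X]; first by case: (leqP Y w2) => //=; lia.
  by case: eqP => [->|w1X']; [lia | move=> /andP[]; lia].
- by rewrite /front /= eqxx leqnn subnn.
- by have := Dm 0; rewrite addn0 /=; apply.
rewrite big_cat big_map /=; congr addn.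
  rewrite {1}/front /= gtn_eqF // eqxx.
  case gY: (g Y); last first.
    by rewrite andbF big1 // => c _; rewrite allowed_cons /= gY.
  rewrite (Dg _ gY) /=.
  rewrite (_ : match_count _ = match_count (front X Y.+1 m (fun h => g h && ~~ (h == Y)))); last first.
    apply: eq_match_count => -[z1 z2] _; rewrite /remove2 /front !xpair_eqE /=.
    case: eqP => [->|n1] /=.
      rewrite (@ltn_eqF X X.+1) //= !andbT; case: (ltngtP Y z2) => h //=; last by rewrite h andbF.
      by rewrite andbT (_ : z2 - Y = (z2 - Y.+1).+1)%N; last lia.
    by case: (z1 =P X.+1) => n2 /=; rewrite ?andbT.
  rewrite IH //; last by move=> h /andP[/Dg].
  apply: eq_bigr => c _; rewrite allowed_cons gY /=.
  rewrite (_ : allowed _ _ c = allowed g Y.+1 c); last first.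
    by apply: eq_all => i /=; rewrite (_ : (_ == Y) = false) ?andbT //; lia.
  by case: ifP => // _; apply: front_rem => h; rewrite remS.
rewrite {1}/front /= eqxx leqnSn subSnn /=.
case: m sm Dm IH Dm1 => [|[] m] sm Dm IH Dm1; rewrite /= ?andbF ?big_nil //.
rewrite andbT (_ : D _ = true); last by have := Dm 1%N; rewrite addn1 /=; apply.
rewrite (_ : match_count _ = match_count (front X Y.+2 m g)); last first.
  apply: eq_match_count => -[z1 z2] _; rewrite /remove2 /front !xpair_eqE /=.
  case: (z1 =P X) => [_|n1] /=; last by rewrite !andbT.
  case: (ltngtP Y z2) => h /=; first last.
  - by rewrite andbF; have -> : (Y.+1 < z2) = false by lia.
  - by have -> : (Y.+1 < z2) = false by lia.
  case: (ltngtP Y.+1 z2) => h2 /=; rewrite ?andbT ?andbF //; last by lia.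
  by rewrite (_ : z2 - Y = (z2 - Y.+2).+2)%N; last lia.
rewrite IH //; last 2 first.
- by move: sm => /=; lia.
- by move=> i /(Dm i.+2); rewrite !addnS !addSn.
rewrite big_map; apply: eq_bigr => c _; rewrite !allowed_cons /=.
case: ifP => // _; apply: front_rem => h; rewrite remS /remaining /=.
rewrite andbT; case: (ltngtP Y.+1 h) => h2 //=; rewrite ?andbT.
  by rewrite (_ : h - Y.+1 = (h - Y.+2).+1)%N //; lia.
by rewrite h2 subnn /= andbT.
Qed.

End ColumnSweep.

(** * Particle configurations and alternating forms *)

Section ParticleDeterminants.
Local Open Scope ring_scope.

(** The cells are coloured alternately, [col] being the colour at height [h]. Particles are the
    [true] entries on one colour and the [false] entries on the other. *)
Fixpoint particles (A : Type) (V : nat -> A) (col : bool) (h : nat) (c : seq bool) : seq A :=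
  if c is b :: c1 then
    if b == col then V h :: particles V (~~ col) h.+1 c1 else particles V (~~ col) h.+1 c1
  else [::].

Lemma eq_particles (A : Type) (V W : nat -> A) col h c :
  (forall i, (h <= i)%N -> V i = W i) -> particles V col h c = particles W col h c.
Proof.
elim: c col h => //= b c IH col h VW; rewrite VW // (IH _ _) // => i hi.
exact: VW (ltnW hi).
Qed.

Section Transfer.
Variables (F : seq (nat -> rat) -> rat) (V : nat -> nat -> rat) (p : bool).
Hypothesis F_add : forall pre u v post,
  F (pre ++ (fun j => u j + v j) :: post) = F (pre ++ u :: post) + F (pre ++ v :: post).
Hypothesis F_dup : forall pre u post, F (pre ++ u :: u :: post) = 0.

Let black h := odd h == p.

(** A free black cell is a particle that goes straight on with a horizontal domino and one step up
    or down with a vertical one; a covered white cell is a particle that stays. Nothing lies below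
    [h0], so no particle moves down from there. *)
Definition hop h0 h : nat -> rat :=
  if black h then
    if (h0 < h)%N then fun j => (V h j + V h.+1 j) + V h.-1 j else fun j => V h j + V h.+1 j
  else V h.

Lemma hop_white h0 h1 h : ~~ black h -> hop h0 h = hop h1 h.
Proof. by rewrite /hop => /negbTE->. Qed.

Lemma hop_high h0 h1 h : (h0 < h)%N -> (h1 < h)%N -> hop h0 h = hop h1 h.
Proof. by rewrite /hop => -> ->. Qed.

(** Additivity expands the right side into all combined hops. Two particles meeting at one height
    give equal adjacent rows and cancel by [F_dup]; the surviving terms are the fills. The
    hypothesis kills the hop of the topmost cell out of the column. *)
Lemma sum_fills h m pre :
  (~~ black (h + size m) -> forall pr, F (pr ++ [:: V (h + size m)]) = 0) ->
  \sum_(c <- fills m) F (pre ++ particles V (black h) h c) =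
  F (pre ++ particles (hop h) (~~ black h) h m).
Proof.
have blackS i : black i.+1 = ~~ black i by rewrite /black /=; case: (odd i); case: p.
have cat1 (s : seq (nat -> rat)) x l : s ++ x :: l = (s ++ [:: x]) ++ l by rewrite -catA.
have above i l : ~~ black i.+1 -> particles (hop i) (black i) i.+1 l =
    particles (hop i.+1) (black i) i.+1 l.
  move=> bi; apply: eq_particles => k; rewrite leq_eqVlt => /predU1P[<-|ik].
    exact: hop_white.
  by apply: hop_high => //; apply: ltnW.
have [n] := ubnP (size m); elim: n m h pre => // n IH [|x m] h pre /= sm top.
  by rewrite big_seq1.
have top1 : ~~ black (h.+1 + size m) -> forall pr, F (pr ++ [:: V (h.+1 + size m)%N]) = 0.
  by rewrite addSnnS.
have IH1 pr : \sum_(c <- fills m) F (pr ++ particles V (~~ black h) h.+1 c) =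
    F (pr ++ particles (hop h.+1) (black h) h.+1 m).
  by have := IH m h.+1 pr sm top1; rewrite blackS negbK.
case: x top sm => top sm.
  rewrite big_map; case bh: (black h) => /=; last first.
    under eq_bigr do rewrite cat1; have := IH1; rewrite bh => /= ->; rewrite -catA /=.
    rewrite (_ : hop h h = V h); last by rewrite /hop bh.
    case: m sm {top top1 IH1} => //= -[] m sm /=.
      congr (F (_ ++ _ :: _)); apply: eq_particles => k hk.
      by apply: hop_high => //; apply: ltnW.
    (* The black particle just above could hop down to [h], but the white particle there stays, so
       the extra row repeats [V h]. *)
    rewrite (_ : hop h h.+1 = fun j => (hop h.+1 h.+1 j + V h j)); last first.
      by rewrite /hop blackS bh ltnn ltnS leqnn.
    rewrite [in RHS]cat1 F_add -[in X in _ = _ + X]catA F_dup addr0 -catA /=.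
    congr (F (_ ++ _ :: _ :: _)); apply: eq_particles => k hk.
    by apply: hop_high => //; apply: ltnW.
  have := IH1; rewrite bh => /= ->; congr (F (_ ++ _)).
  by have := @above h m; rewrite blackS bh => ->.
rewrite big_cat big_map /=.
case bh: (black h) => /=.
  under eq_bigr do rewrite cat1; have := IH1; rewrite bh => /= ->; rewrite -catA /=.
  (* The lowest black particle goes straight on or up. The upward term survives only if a free white
     cell lies above; otherwise it leaves the column or repeats the row of a resting particle. *)
  rewrite (_ : hop h h = fun j => V h j + V h.+1 j); last by rewrite /hop bh ltnn.
  rewrite F_add; have := @above h m; rewrite blackS bh => -> //; congr (_ + _).
  case: m sm IH1 top top1 => [|[] m] sm IH1 top top1 /=.
  - by rewrite big_nil; have := top1; rewrite addn0 blackS bh => ->.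
  - rewrite big_nil (_ : hop h.+1 h.+1 = V h.+1) ?F_dup //.
    by rewrite /hop blackS bh.
  rewrite big_map /=.
  under eq_bigr do rewrite cat1.
  have bh2 : black h.+2 = true by rewrite !blackS bh.
  have := IH m h.+2 (pre ++ [:: V h.+1]); rewrite bh2 => /= ->; last 2 first.
  - by move: sm => /=; lia.
  - by have := top; rewrite /= !addSnnS.
  rewrite -catA /=; case: m sm {IH1 top top1} => //= -[] m sm /=.
    congr (F (_ ++ _ :: _)); apply: eq_particles => k hk.
    by apply: hop_high => //; apply: ltnW.
  rewrite (_ : hop h.+1 h.+2 = fun j => (hop h.+2 h.+2 j + V h.+1 j)); last first.
    by rewrite /hop bh2 ltnn ltnS leqnn.
  rewrite [in RHS]cat1 F_add -[in X in _ = _ + X]catA F_dup addr0 -catA /=.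
  congr (F (_ ++ _ :: _ :: _)); apply: eq_particles => k hk.
  by apply: hop_high => //; apply: ltnW.
have := IH1; rewrite bh => /= ->.
have far k : (h.+2 <= k)%N -> hop h k = hop h.+1 k.
  by move=> hk; apply: hop_high => //; apply: ltnW.
case: m sm IH1 top top1 => [|[] m] sm IH1 top top1 /=; rewrite ?big_nil ?addr0 //.
  by rewrite (eq_particles _ _ far).
(* The white cell at [h] is free and carries no particle; the black particle above may drop into it,
   which is the vertical domino on the two cells. *)
rewrite (_ : hop h h.+1 = fun j => hop h.+1 h.+1 j + V h j); last first.
  by rewrite /hop blackS bh ltnn ltnS leqnn.
rewrite F_add (eq_particles _ _ far); congr (_ + _).
rewrite big_map /=; under eq_bigr do rewrite cat1.
have bh2 : black h.+2 = false by rewrite !blackS bh.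
have := IH m h.+2 (pre ++ [:: V h]); rewrite bh2 => /= ->; last 2 first.
- by move: sm => /=; lia.
- by have := top; rewrite /= !addSnnS.
rewrite -catA /=; congr (F (_ ++ _ :: _)); apply: eq_particles => k.
rewrite leq_eqVlt => /predU1P[<-|hk].
  by apply: hop_white; rewrite bh2.
by apply: hop_high => //; apply: ltnW.
Qed.

End Transfer.

Section RowDeterminant.
Variable n : nat.

Definition row_matrix (s : seq (nat -> rat)) : 'M[rat]_n :=
  \matrix_(i, j) nth (fun _ => 0) s i j.

(** The value 0 for a wrong number of rows lets the sums run over all fills, whatever their number
    of particles. *)
Definition rowdet (s : seq (nat -> rat)) : rat :=
  if size s == n then \det (row_matrix s) else 0.

Lemma rowdetD (pre : seq (nat -> rat)) (u v : nat -> rat) (post : seq (nat -> rat)) :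
  rowdet (pre ++ (fun j => u j + v j) :: post) =
  rowdet (pre ++ u :: post) + rowdet (pre ++ v :: post).
Proof.
rewrite /rowdet !size_cat /=; case: eqP => [sz|_]; last by rewrite addr0.
have lt : (size pre < n)%N by rewrite -sz -addSnnS leq_addr.
have nth_at (w : nat -> rat) : nth (fun _ => 0) (pre ++ w :: post) (size pre) = w.
  by rewrite nth_cat ltnn subnn.
have nth_other (w w' : nat -> rat) i : i != size pre ->
    nth (fun _ => 0) (pre ++ w :: post) i = nth (fun _ => 0) (pre ++ w' :: post) i.
  rewrite !nth_cat; case: ltngtP => h //.
  by rewrite -(prednK (n := i - size pre)) ?subn_gt0.
rewrite (@determinant_multilinear _ _ _ (row_matrix (pre ++ u :: post))
  (row_matrix (pre ++ v :: post)) (Ordinal lt) 1 1) ?mul1r //.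
- by apply/rowP => j; rewrite !mxE /= !nth_at !mul1r.
all: apply/matrixP => i j; rewrite !mxE;
  rewrite (nth_other _ (fun j => u j + v j)) //;
  by rewrite eq_sym; apply/(neq_lift (Ordinal lt)).
Qed.

Lemma rowdet_dup (pre : seq (nat -> rat)) (u : nat -> rat) (post : seq (nat -> rat)) :
  rowdet (pre ++ u :: u :: post) = 0.
Proof.
rewrite /rowdet !size_cat /=; case: eqP => // sz.
have lt : (size pre < n)%N by rewrite -sz -addSnnS leq_addr.
have lt1 : ((size pre).+1 < n)%N by rewrite -sz -!addSnnS leq_addr.
apply: (@determinant_alternate _ _ _ (Ordinal lt) (Ordinal lt1)).
  by apply/eqP => /(congr1 val) /=; lia.
by move=> j; rewrite !mxE !nth_cat /= ltnn subnn ltnNge leqnSn /= subSnn.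
Qed.

Lemma eq_rowdet (s t : seq (nat -> rat)) : size s = size t ->
  (forall i j, (i < size s)%N -> (j < n)%N ->
     nth (fun _ => 0) s i j = nth (fun _ => 0) t i j) ->
  rowdet s = rowdet t.
Proof.
move=> sz E; rewrite /rowdet -sz; case: eqP => // sn; congr (\det _).
by apply/matrixP => i j; rewrite !mxE E // sn.
Qed.

Lemma rowdet_zero (pre : seq (nat -> rat)) (u : nat -> rat) :
  (forall j, (j < n)%N -> u j = 0) -> rowdet (pre ++ [:: u]) = 0.
Proof.
move=> u0; rewrite /rowdet size_cat /=; case: eqP => // sz.
have lt : (size pre < n)%N by rewrite -sz -addSnnS leq_addr.
rewrite (expand_det_row _ (Ordinal lt)) big1 // => j _.
by rewrite mxE nth_cat ltnn subnn /= u0 ?mul0r.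
Qed.

End RowDeterminant.

End ParticleDeterminants.

(** * Coefficients of the powers of w and determinants of fronts *)

(* [wcoef c d] is the coefficient of y^c in w^d, where w (1 - y^2) = y (1 + w^2). *)
Fixpoint wcoef (c d : nat) : nat :=
  match c, d with
  | 0, 0 => 1
  | 0, _.+1 => 0
  | _.+1, 0 => 0
  | c1.+1, d1.+1 => wcoef c1 d1 + wcoef c1 d1.+2 + (if c1 is c2.+1 then wcoef c2 d1.+1 else 0)
  end.

Arguments wcoef : simpl never.

Lemma wcoef0S d : wcoef 0 d.+1 = 0. Proof. by []. Qed.

Lemma wcoefS0 c : wcoef c.+1 0 = 0. Proof. by []. Qed.

Lemma wcoefSS c d : wcoef c.+2 d.+1 = wcoef c.+1 d + wcoef c.+1 d.+2 + wcoef c d.+1. Proof. by []. Qed.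

Lemma nat_ind2 (P : nat -> Prop) : P 0 -> P 1%N -> (forall c, P c -> P c.+1 -> P c.+2) ->
  forall c, P c.
Proof.
by move=> P0 P1 PS c; have [] : P c /\ P c.+1; last by []; elim: c => [|c []]; split; auto.
Qed.

Lemma wcoef_odd c d : odd (c + d) -> wcoef c d = 0.
Proof.
elim/nat_ind2: c d => [|d|c IH1 IH2 [|d] //]; first by case.
  by case: d => [|[|[|d]]].
by rewrite wcoefSS => h; rewrite IH1 ?IH2; lia.
Qed.

Lemma wcoef_gt c d : (c < d)%N -> wcoef c d = 0.
Proof.
elim/nat_ind2: c d => [|d|c IH1 IH2 [|d] //]; first by case.
  by case: d => [|[|[|d]]].
by rewrite wcoefSS => h; rewrite IH1 ?IH2; lia.
Qed.

(** This is w^(d+1) = w w^d read off at y^(c+1). *)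
Lemma wcoef_shift c d : wcoef c.+1 d.+1 = (\sum_(e < c.+1) wcoef e.+1 1 * wcoef (c - e) d)%N.
Proof.
have [n] := ubnP c; elim: n c d => // n IH c [|d] cn.
  rewrite big_ord_recr /= subnn [wcoef 0 0]/= muln1 big1 ?add0n // => e _.
  by have := ltn_ord e; case E: (c - e)%N => [|x]; rewrite ?wcoefS0 ?muln0 //; lia.
case: c cn => [|c] cn; first by rewrite big_ord_recr big_ord0 /= wcoef0S muln0.
rewrite wcoefSS big_ord_recr /= subnn wcoef0S muln0 addn0 !IH // -big_split /=.
have -> : wcoef c d.+2 = (\sum_(e < c.+1) wcoef e.+1 1 *
    (if (c - e)%N is x.+1 then wcoef x d.+1 else 0))%N.
  case: c cn => [|c] cn; first by rewrite big_ord_recr big_ord0 muln0.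
  rewrite IH; last by lia.
  rewrite [RHS]big_ord_recr /= subnn muln0 addn0; apply: eq_bigr => e _.
  by rewrite subSn // -ltnS ltn_ord.
rewrite -big_split /=; apply: eq_bigr => e _.
rewrite subSn; last by rewrite -ltnS ltn_ord.
rewrite -!mulnDr; congr muln.
Qed.

Section TransferRows.
Local Open Scope ring_scope.

(* In each position only one of the two summands is nonzero, by parity. *)
Definition trow s h : nat -> rat := fun l => (wcoef (s + 2 * l).+1 h.+1 + wcoef (s + 2 * l) h.+1)%:R.

(** Particles stand where the mask entry is the parity of [s] plus the height, so the colours swap
    whenever [s] grows by one. *)
Definition front_det n s (m : seq bool) : rat := rowdet n (particles (trow s) (odd s) 0 m).

Lemma nth_particles (V W : nat -> nat -> rat) col h c (x : nat -> rat) i j :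
  (forall h j, V h j = W h j) ->
  nth x (particles V col h c) i j = nth x (particles W col h c) i j.
Proof. by move=> VW; elim: c col h i => //= b c IH col h [|i]; case: ifP => /=. Qed.

Lemma size_particles (A B : Type) (V : nat -> A) (W : nat -> B) col h h' c :
  size (particles V col h c) = size (particles W col h' c).
Proof. by elim: c col h h' => //= b c IH col h h'; case: ifP => /=; rewrite (IH _ _ h'.+1). Qed.

(** At the heights where particles hop this is the recurrence of [wcoef]; at the others both sides
    keep the one coefficient of the right parity. The missing downward hop at height 0 costs
    nothing, as w^0 has no coefficient of positive degree. *)
Lemma hop_trow s h l : hop (trow s) (~~ odd s) 0 h l = trow s.+1 h l.
Proof.
rewrite /hop; case: (boolP (odd h == ~~ odd s)) => bh.
  have z1 : wcoef (s + 2 * l).+1 h.+1 = 0%N by apply: wcoef_odd; lia.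
  have z2 : wcoef (s + 2 * l) h.+2 = 0%N by apply: wcoef_odd; lia.
  have z3 : wcoef (s + 2 * l) h = 0%N by apply: wcoef_odd; lia.
  rewrite /trow !addSn !wcoefSS; case: h bh z1 z2 z3 => [|h] bh z1 z2 z3 /=.
    by rewrite -natrD wcoefS0 z1 z2; congr _%:R; lia.
  by rewrite -!natrD z1 z2 z3; congr _%:R; lia.
have z1 : wcoef (s + 2 * l).+2 h.+1 = 0%N by apply: wcoef_odd; lia.
have z2 : wcoef (s + 2 * l) h.+1 = 0%N by apply: wcoef_odd; lia.
by rewrite /trow !addSn z1 z2 addn0.
Qed.

Lemma trow_zero s h l : (s + 2 * l < h)%N -> trow s h l = 0.
Proof. by move=> lt; rewrite /trow !wcoef_gt //; lia. Qed.

(** If a particle could hop out at the top of the mask, the hypothesis makes the row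
    [trow s (size m)] vanish in all [n] columns. *)
Lemma sum_front_det n s m :
  (~~ odd (s + size m) -> (s + 2 * n <= (size m).+1)%N) ->
  \sum_(c <- fills m) front_det n s c = front_det n s.+1 m.
Proof.
move=> top.
have := @sum_fills (rowdet n) (trow s) (~~ odd s) (@rowdetD n) (@rowdet_dup n) 0 m [::].
rewrite /= => E.
transitivity (rowdet n (particles (hop (trow s) (~~ odd s) 0) (~~ odd s) 0 m)).
  rewrite (_ : false == ~~ odd s = odd s) in E; last by case: odd.
  rewrite -E // add0n => bm pr; apply: rowdet_zero => j jn.
  rewrite trow_zero //.
  have : ~~ odd (s + size m) by rewrite oddD; move: bm; case: odd; case: odd.
  by move/top; lia.
apply: eq_rowdet => [|i j _ _]; first exact: size_particles.
exact/nth_particles/hop_trow.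
Qed.

End TransferRows.

Lemma particles_rcons (A : Type) (V : nat -> A) col h c b :
  particles V col h (rcons c b) = particles V col h c ++
    (if b == col (+) odd (size c) then [:: V (h + size c)] else [::]).
Proof.
elim: c col h => [|x c IH] col h /=; first by rewrite addn0 addbF.
by rewrite IH addSnnS addNb addbN; case: ifP.
Qed.

Lemma particles_S (A : Type) (V : nat -> A) col h c :
  particles V col h.+1 c = particles (fun i => V i.+1) col h c.
Proof. by elim: c col h => //= b c IH col h; rewrite IH. Qed.

Section FrontDeterminant.
Local Open Scope ring_scope.

Lemma front_det_rcons_out n s (c : seq bool) (b : bool) : b != odd s (+) odd (size c) ->
  front_det n s (rcons c b) = front_det n s c.
Proof. by rewrite /front_det particles_rcons => /negbTE->; rewrite cats0. Qed.

Lemma front_det_rcons_in n s (c : seq bool) (b : bool) : b == odd s (+) odd (size c) ->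
  (s + 2 * n <= (size c).+1)%N -> front_det n s (rcons c b) = 0.
Proof.
rewrite /front_det particles_rcons => -> sz; apply: rowdet_zero => j jn.
by rewrite add0n trow_zero //; lia.
Qed.

Lemma nth_particles_trow0 col h c i :
  nth (fun _ => 0) (particles (trow 0) col h.+1 c) i 0%N = 0.
Proof.
elim: c col h i => [|b c IH] col h i /=; first by rewrite nth_nil.
by case: ifP => // _; case: i => //= [|i //]; rewrite /trow !wcoef_gt.
Qed.

(** Since w^(h+1) begins with y^(h+1), only a particle at height 0 has a nonzero entry in the first
    column at [s = 0], and here there is none. *)
Lemma front_det_cons_true n c : front_det n.+1 0 (true :: c) = 0.
Proof.
rewrite /front_det /= /rowdet; case: eqP => // _.
by rewrite (expand_det_col _ ord0) big1 // => i _; rewrite mxE nth_particles_trow0 mul0r.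
Qed.

(** Multiplication by the even series w/y, on the coefficients of every second degree. *)
Definition shift_row (v : nat -> rat) : nat -> rat :=
  fun l => \sum_(j < l.+1) (wcoef (2 * (l - j)).+1 1)%:R * v j.

Lemma sum_even n (F : nat -> nat) : (forall i, odd i -> F i = 0%N) ->
  (\sum_(i < n.*2) F i = \sum_(i < n) F (2 * i))%N.
Proof.
move=> F0; elim: n => [|n IH]; first by rewrite !big_ord0.
rewrite doubleS !big_ord_recr /= IH -addnA; congr addn.
by rewrite [F n.*2.+1]F0 ?addn0 ?mul2n //= odd_double.
Qed.

Lemma trow_shift h l : trow 0 h.+1 l.+1 = shift_row (trow 1 h) l.
Proof.
have u0 i : odd i -> wcoef i.+1 1 = 0%N by move=> oi; apply: wcoef_odd; lia.
have term c d : wcoef c.+1 d.+1 = (\sum_(i < (c./2).+1) wcoef (2 * i).+1 1 * wcoef (c - 2 * i) d)%N.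
  rewrite wcoef_shift; case: (boolP (odd c)) => oc.
    have -> : c.+1 = (c./2).+1.*2 by lia.
    by rewrite (@sum_even _ (fun i => wcoef i.+1 1 * wcoef (c - i) d)%N) // => i /u0->.
  have -> : c.+1 = (c./2).*2.+1 by lia.
  rewrite big_ord_recr /= (@sum_even _ (fun i => wcoef i.+1 1 * wcoef (c - i) d)%N).
    by rewrite [RHS]big_ord_recr /= mul2n.
  by move=> i /u0->.
rewrite /trow /shift_row add0n !(mulnS 2) !addSn add0n !term.
have -> : (2 * l).+1./2 = l by lia.
have -> : (2 * l).+2./2 = l.+1 by lia.
rewrite big_ord_recr /= [((2 * l).+2 - _)%N](_ : _ = 0%N); last by lia.
rewrite wcoef0S muln0 addn0 -big_split /= natr_sum (reindex_inj rev_ord_inj) /=.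
apply: eq_bigr => i _; have il := ltn_ord i.
rewrite subSS -mulnDr natrM; congr (_ * (wcoef _ _ + wcoef _ _)%:R); lia.
Qed.

Lemma nth_particles_shift col h c i j :
  nth (fun _ => 0) (particles (fun k => trow 0 k.+1) col h c) i j.+1 =
  shift_row (nth (fun _ => 0) (particles (trow 1) col h c) i) j.
Proof.
elim: c col h i => [|b c IH] col h i /=; last first.
  by case: ifP => // _; case: i => //= *; rewrite trow_shift.
by rewrite nth_nil /shift_row big1 // => k _; rewrite mulr0.
Qed.

(** The bottom particle has the only nonzero entry of the first column and is split off by
    expansion. The other rows contain a factor w/y, which is removed by a unitriangular column
    operation. *)
Lemma front_det_cons_false n c : front_det n.+1 0 (false :: c) = front_det n 1 c.
Proof.
rewrite /front_det /= particles_S.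
set s1 := particles _ _ _ c; set s2 := particles (trow 1) _ _ c.
have sz : size s1 = size s2 by exact: size_particles.
rewrite /rowdet /= eqSS -sz; case: eqP => // sn.
rewrite (expand_det_col _ ord0) big_ord_recl big1 ?addr0; last first.
  by move=> i _; rewrite mxE /= /s1 -particles_S nth_particles_trow0 mul0r.
rewrite mxE /= [X in X * _](_ : _ = 1) // mul1r /cofactor /= expr0 mul1r.
(* The matrix of [shift_row], with the constant term 1 of w/y on its diagonal. *)
pose U : 'M[rat]_n := \matrix_(i, j) if (i <= j)%N then (wcoef (2 * (j - i)).+1 1)%:R else 0.
have dU : \det U = 1.
  rewrite -det_tr det_trig; last first.
    by apply/is_trig_mxP => i j ij; rewrite !mxE leqNgt ij.
  by rewrite big1 // => i _; rewrite !mxE leqnn subnn.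
rewrite -[RHS]mulr1 -dU -det_mulmx; congr (\det _); apply/matrixP => i j.
rewrite !mxE /=.
rewrite (_ : nth _ s1 i _ = shift_row (nth (fun _ => 0) s2 i) j); last first.
  exact: nth_particles_shift.
rewrite /shift_row.
rewrite (big_ord_widen n (fun k => (wcoef (2 * (j - k)).+1 1)%:R * nth (fun _ => 0) s2 i k)) //.
rewrite big_mkcond /=; apply: eq_bigr => k _; rewrite !mxE ltnS.
by case: ifP => _; rewrite ?mulr0 // mulrC.
Qed.

End FrontDeterminant.

(** * The sweep across a truncated diamond *)

Section TruncatedDiamond.
Variables (k a b : nat).
Hypotheses (a_le : a <= k.+1) (b_le : b <= k).

(* [r] is the number of columns that are still to be swept, the current one
   included; heights are measured from the truncating horizontal line. *)
Definition col_lo r := b - r.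
Definition col_hi r := if r <= k then b + r else (2 * k + 1 + b) - r.
Definition diamond_cell (z : nat * nat) : bool :=
  col_lo (k + a - z.1) <= z.2 < col_hi (k + a - z.1).

Let D := diamond_cell.

Variables (T : finType) (e : rel T) (pos : T -> nat * nat).
Hypothesis pos_inj : injective pos.
Hypothesis posP : forall z, reflect (exists c, pos c = z) (D z).
Hypothesis eE : forall c d, e c d = grid_adj (pos c) (pos d).

Local Notation match_count := (match_count e pos).
Local Notation front := (front D).
Local Notation next X := (fun h => D (X.+1, h)).

(** A finished column is dropped, and the free heights [g] of the next one are recoded as a mask. *)
Lemma next_front X lo c (g : pred nat) :
  (forall h, g h = (lo <= h) && ~~ nth true c (h - lo)) ->
  match_count (front X 0 [::] g) = match_count (front X.+1 lo c (next X.+1)).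
Proof.
move=> gE; apply: (eq_match_count e posP) => -[z1 z2] _; rewrite /front nth_nil /= ?andbF gE.
have [->|h1] := eqVneq z1 X.
  by rewrite !ltn_eqF ?ltnS ?leqnSn // ltnNge leqnSn.
have [_|h2] := eqVneq z1 X.+1; first by [].
have [->|h3] := eqVneq z1 X.+2; first by rewrite ltnS leqnSn.
by congr andb; lia.
Qed.

Local Open Scope ring_scope.

(** The transfer rule reduces a column to its single fills. A fill whose dominoes stick out of the
    next column has to have determinant 0. *)
Lemma column_step X lo m n s :
  (forall i, ~~ nth true m i -> D (X, lo + i)%N) ->
  (~~ odd (s + size m) -> (s + 2 * n <= (size m).+1)%N) ->
  (forall c, size c = size m ->
    (if allowed (next X) lo c then (match_count (front X 0 [::] (remaining (next X) lo c)))%:R else 0)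
    = front_det n s c) ->
  (match_count (front X lo m (next X)))%:R = front_det n s.+1 m.
Proof.
move=> mD top val; rewrite (match_count_front pos_inj posP eE) // natr_sum -sum_front_det //.
rewrite big_seq [RHS]big_seq; apply: eq_bigr => c /(allP (size_fills m))/eqP/val <-.
by case: ifP.
Qed.

(** [minn r b] counts the steps of the lower right boundary still ahead, each of which removes a
    particle. Along that boundary the index stays 1, since removing the bottom particle makes up for
    the column passed. *)
Definition column_count r := forall m : seq bool, size m = (col_hi r - col_lo r)%N ->
  (match_count (front (k + a - r) (col_lo r) m (next (k + a - r))))%:R =
  front_det (minn r b) (r - b).+1 m.

Lemma remaining_E lo lo' (g : pred nat) (c c' : seq bool) hi' :
  (forall h, g h = (lo' <= h < hi')%N) ->
  (forall h, (lo' <= h < hi')%N -> nth true c' (h - lo') = (lo <= h)%N && nth false c (h - lo)) ->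
  (size c' <= hi' - lo')%N ->
  forall h, remaining g lo c h = (lo' <= h)%N && ~~ nth true c' (h - lo').
Proof.
move=> gE E sz h; rewrite /remaining gE.
case: (leqP lo' h) => //= l1; case: (ltnP h hi') => //= h1; first by rewrite E ?l1.
by rewrite nth_default //; lia.
Qed.

Lemma mask_in_column r (m : seq bool) i : (r <= k + a)%N ->
  size m = (col_hi r - col_lo r)%N ->
  ~~ nth true m i -> D (k + a - r, col_lo r + i)%N.
Proof.
move=> rR sm; case: (ltnP i (size m)) => h; last by rewrite nth_default.
by rewrite /D /diamond_cell /= subKn // leq_addr /=; move: h; rewrite sm; lia.
Qed.

Lemma nextE r : (r < k + a)%N -> forall h,
  D ((k + a - r.+1).+1, h) = (col_lo r <= h < col_hi r)%N.
Proof. by move=> rR h; rewrite /D /diamond_cell /= subnSK // subKn // ltnW. Qed.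

Lemma next_count r (c c' : seq bool) : (r < k + a)%N -> column_count r ->
  size c' = (col_hi r - col_lo r)%N ->
  (forall h, (col_lo r <= h < col_hi r)%N ->
     nth true c' (h - col_lo r) = (col_lo r.+1 <= h)%N && nth false c (h - col_lo r.+1)) ->
  (match_count (front (k + a - r.+1) 0 [::] (remaining (next (k + a - r.+1)) (col_lo r.+1) c)))%:R =
  front_det (minn r b) (r - b).+1 c'.
Proof.
move=> rR IH sz E; rewrite -IH // (@next_front _ (col_lo r) c') ?subnSK //.
apply: (@remaining_E _ _ _ _ _ (col_hi r)) => //; last by rewrite sz.
by move=> h; rewrite -nextE // subnSK.
Qed.

Lemma allowedP r lo (c : seq bool) : (r < k + a)%N ->
  reflect (forall i, (i < size c)%N -> nth false c i -> (col_lo r <= lo + i < col_hi r)%N)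
    (allowed (next (k + a - r.+1)) lo c).
Proof.
move=> rR; apply: (iffP allP) => [h i ic ci|h i].
  by have := h i; rewrite mem_iota ic => /(_ isT); rewrite ci nextE.
by rewrite mem_iota => /= ic; rewrite nextE //; apply/implyP/h.
Qed.

Lemma column_count0 : column_count 0.
Proof.
move=> m; rewrite /col_hi /col_lo /= addn0 subn0 subnn => /size0nil ->.
rewrite subn0 min0n /front_det /rowdet /= det_mx00 (match_count_empty e posP) // => -[z1 z2].
rewrite {1}/D /diamond_cell /front /col_lo /col_hi /= => h.
have z1_lt : (z1 < k + a)%N.
  rewrite ltnNge; apply/negP => z1_ge; move: h.
  by rewrite (_ : k + a - z1 = 0)%N /=; lia.
by rewrite !ltn_eqF ?ltnS ?(ltnW z1_lt) // ltnNge (ltnW z1_lt).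
Qed.

(** The next column is one cell shorter at either end. A domino sent across the bottom end makes the
    first column of the matrix vanish, one across the top end makes the last row vanish; in all
    other fills the bottom particle leaves. *)
Lemma column_count_low r : (r < b)%N -> column_count r -> column_count r.+1.
Proof.
move=> rb IH m sm; have rR : (r < k + a)%N by lia.
have lo1 : col_lo r = (col_lo r.+1).+1 by rewrite /col_lo; lia.
have rk : (r < k)%N by apply: leq_trans b_le.
have hi0 : col_hi r = (b + r)%N by rewrite /col_hi ltnW.
have hi1 : col_hi r.+1 = (b + r).+1 by rewrite /col_hi rk addnS.
have lo0 : (col_lo r + r = b)%N by rewrite /col_lo subnK // ltnW.
have sm2 : size m = (2 * r).+2 by rewrite sm hi1; lia.
rewrite (minn_idPl _) // (_ : r.+1 - b = 0)%N; last by lia.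
apply: column_step => [i|_|].
- exact: mask_in_column.
- by rewrite sm2; lia.
case=> [|x c]; first by rewrite sm2.
case/lastP: c => [|c t]; first by rewrite sm2 => -[].
rewrite sm2 /= size_rcons => -[sc].
case: x.
  rewrite front_det_cons_true; case: allowedP => // /(_ 0%N isT isT).
  by rewrite lo1 addn0 ltnn.
rewrite -rcons_cons; case: t.
  rewrite front_det_rcons_in //= ?sc ?oddM //; last by lia.
  case: allowedP => // /(_ (2 * r).+1).
  rewrite /= size_rcons sc leqnn nth_rcons sc ltnn eqxx => /(_ isT isT).
  by rewrite -addSnnS -lo1; lia.
rewrite front_det_rcons_out //= ?sc ?oddM // front_det_cons_false.
case: allowedP => // [_|[]]; last first.
  move=> i; rewrite /= size_rcons sc => ic; case: i ic => // i ic; rewrite /= nth_rcons sc.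
  by case: ltnP => ic2; [move=> _; lia | case: eqP].
rewrite (@next_count _ _ c) ?(minn_idPl _) ?(ltnW rb) //; try lia.
  by congr (front_det _ _.+1 _); lia.
move=> h hh; rewrite -rcons_cons.
rewrite (_ : h - col_lo r.+1 = (h - col_lo r).+1)%N /=; last by lia.
rewrite nth_rcons ifT; last by lia.
by rewrite (set_nth_default true) //; lia.
Qed.

(** The lower end is level with the truncating line, and only the top cell is lost. *)
Lemma column_count_right r : (b <= r < k)%N -> column_count r -> column_count r.+1.
Proof.
move=> /andP[rb rk] IH m sm; have rR : (r < k + a)%N by lia.
have lo0 : col_lo r = 0%N by rewrite /col_lo; lia.
have lo1 : col_lo r.+1 = 0%N by rewrite /col_lo; lia.
have hi0 : col_hi r = (b + r)%N by rewrite /col_hi ltnW.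
have hi1 : col_hi r.+1 = (b + r).+1 by rewrite /col_hi rk addnS.
have sm2 : size m = (b + r).+1 by rewrite sm lo1 hi1; lia.
rewrite (minn_idPr _) ?(leqW rb) //.
apply: column_step => [i|_|].
- exact: mask_in_column.
- by rewrite sm2; lia.
move=> c; case/lastP: c => [|c t]; first by rewrite sm2.
rewrite sm2 size_rcons => -[sc].
case: t.
  rewrite front_det_rcons_in ?sc //; [|lia|lia].
  case: allowedP => // /(_ (b + r)%N).
  by rewrite size_rcons sc leqnn nth_rcons sc ltnn eqxx lo1 lo0 hi0 add0n ltnn => /(_ isT isT).
rewrite front_det_rcons_out ?sc //; last by lia.
case: allowedP => // [_|[]]; last first.
  move=> i; rewrite size_rcons sc => ic; rewrite nth_rcons sc.
  by case: ltnP => ic2; [move=> _; lia | case: eqP].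
rewrite (@next_count _ _ c) ?(minn_idPr _) //; last first.
- move=> h hh; rewrite lo0 lo1 subn0 /= nth_rcons ifT; last by lia.
  by rewrite (set_nth_default true) //; lia.
- by rewrite sc; lia.
by congr (front_det _ _ _); lia.
Qed.

(** The two central columns have the same height, so every fill is allowed. *)
Lemma column_count_middle : (0 < a)%N -> column_count k -> column_count k.+1.
Proof.
move=> a0 IH m sm; have rR : (k < k + a)%N by lia.
have lo0 : col_lo k = 0%N by rewrite /col_lo; lia.
have lo1 : col_lo k.+1 = 0%N by rewrite /col_lo; lia.
have hi0 : col_hi k = (b + k)%N by rewrite /col_hi leqnn.
have hi1 : col_hi k.+1 = (b + k)%N by rewrite /col_hi ltnn; lia.
have sm2 : size m = (b + k)%N by rewrite sm lo1 hi1; lia.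
rewrite (minn_idPr _) ?(leqW b_le) //.
apply: column_step => [i||].
- exact: mask_in_column.
- by rewrite sm2; lia.
move=> c sc; rewrite sm2 in sc.
case: allowedP => // [_|[]]; last by move=> i; rewrite sc => ic; lia.
rewrite (@next_count _ _ c) ?(minn_idPr _) //; last first.
- move=> h hh; rewrite lo0 lo1 subn0 /=.
  by rewrite (set_nth_default true) //; lia.
- by rewrite sc; lia.
by congr (front_det _ _ _); lia.
Qed.

(** The next column is one cell higher; its new top cell is free and, by parity, carries no
    particle. *)
Lemma column_count_left r : (k < r < k + a)%N -> column_count r -> column_count r.+1.
Proof.
move=> /andP[kr rR] IH m sm.
have lo0 : col_lo r = 0%N by rewrite /col_lo; lia.
have lo1 : col_lo r.+1 = 0%N by rewrite /col_lo; lia.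
have hi0 : col_hi r = (2 * k + 1 + b - r)%N by rewrite /col_hi leqNgt kr.
have hi1 : col_hi r.+1 = (2 * k + 1 + b - r.+1)%N by rewrite /col_hi leqNgt ltnW.
have sm2 : size m = (2 * k + b - r)%N by rewrite sm lo1 hi1; lia.
rewrite (minn_idPr _); last by lia.
apply: column_step => [i||].
- exact: mask_in_column.
- by rewrite sm2; lia.
move=> c sc; rewrite sm2 in sc.
case: allowedP => // [_|[]]; last by move=> i; rewrite sc => ic; lia.
rewrite (@next_count _ _ (rcons c false)) ?(minn_idPr _) //; last first.
- move=> h hh; rewrite lo0 lo1 subn0 /= nth_rcons.
  case: ltnP => hc; first by rewrite (set_nth_default true).
  by rewrite ifT ?nth_default //; lia.
- by rewrite size_rcons sc; lia.
- by lia.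
rewrite front_det_rcons_out; last by rewrite sc; lia.
by congr (front_det _ _ _); lia.
Qed.

Lemma column_countP r : (r <= k + a)%N -> column_count r.
Proof.
elim: r => [_|r IH rR]; first exact: column_count0.
have {}IH := IH (ltnW rR); case: (ltnP r b) => rb; first exact: column_count_low.
case: (ltngtP r k) => rk; first by apply: column_count_right => //; rewrite rb.
  by apply: column_count_left => //; rewrite rk.
by move: IH; rewrite rk => IH; apply: column_count_middle => //; lia.
Qed.

Lemma card_diamond_matchings : (0 < a)%N ->
  #|matchings e setT|%:R = front_det b (k + a - b).+1 (nseq (k + 1 + b - a) false).
Proof.
move=> a_gt0.
have lo0 : col_lo (k + a) = 0%N by rewrite /col_lo; lia.
have hi0 : col_hi (k + a) = (k + 1 + b - a)%N by rewrite /col_hi ifF; lia.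
have := @column_countP (k + a) (leqnn _) (nseq (k + 1 + b - a) false).
rewrite lo0 hi0 size_nseq subn0 subnn (minn_idPr _); last by lia.
move=> <- //; congr (_%:R); rewrite [LHS](_ : _ = match_count D); last first.
  congr #|pred_of_set (matchings _ _)|; apply/setP => c; rewrite !inE.
  by apply/esym/posP; exists c.
apply: (eq_match_count e posP) => -[z1 z2] _; rewrite /front /=.
have [->|z1_neq0] := eqVneq z1 0%N.
  by rewrite /D /diamond_cell /= !subn0 lo0 hi0 nth_nseq; case: (z2 < _)%N.
by have [->//|_] := eqVneq z1 1%N; rewrite lt0n z1_neq0.
Qed.
End TruncatedDiamond.

(** * The initial front and the tilings of the region *)

Lemma particles_nseq (A : Type) (V : nat -> A) h n :
  particles V false h (nseq (2 * n) false) = mkseq (fun i => V (h + 2 * i)%N) n.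
Proof.
elim: n h => [//|n IH] h; rewrite mulnS /= IH /mkseq /= addn0; congr cons.
rewrite -[1%N]addn0 iotaDl -map_comp; apply: eq_map => i /=.
by congr V; lia.
Qed.

Section InitialFront.
Local Open Scope ring_scope.

Lemma rowdet_mkseq n (f : nat -> nat -> rat) :
  rowdet n (mkseq f n) = \det (\matrix_(i < n, j < n) f i j).
Proof.
rewrite /rowdet size_mkseq eqxx; congr (\det _); apply/matrixP => i j.
by rewrite !mxE nth_mkseq.
Qed.

(** In a column of free cells the particles occupy every second height, starting at [e]; by parity
    one summand of [trow] is zero there. *)
Lemma front_det_nseq a b e (e_le1 : (e <= 1)%N) : (0 < a)%N ->
  front_det b (2 * a - 1 + e).+1 (nseq (2 * b + e) false) =
  \det (\matrix_(i < b, j < b) (wcoef (2 * (a + j) + e).+1 (2 * i + e).+1)%:R).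
Proof.
move=> a_gt0; rewrite /front_det.
have -> : particles (trow (2 * a - 1 + e).+1) (odd (2 * a - 1 + e).+1) 0 (nseq (2 * b + e) false) =
    mkseq (fun i => trow (2 * a - 1 + e).+1 (2 * i + e)%N) b.
  case: e e_le1 => [|[|//]] _.
    rewrite !addn0 (_ : odd _ = false) ?particles_nseq; last by lia.
    by apply: eq_mkseq => i; rewrite addn0.
  rewrite (_ : odd _ = true); last by lia.
  rewrite [(2 * b + 1)%N]addn1 /= particles_nseq; apply: eq_mkseq => i; congr trow; lia.
rewrite rowdet_mkseq; congr (\det _); apply/matrixP => i j; rewrite !mxE /trow.
have -> : ((2 * a - 1 + e).+1 + 2 * j = 2 * (a + j) + e)%N by lia.
by rewrite [X in (_ + X)%:R]wcoef_odd ?addn0 //; lia.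
Qed.

End InitialFront.

Section TilingCount.
Local Open Scope fset_scope.
Local Open Scope ring_scope.

Lemma in_AD_int (k : nat) (c : cell) :
  (c \in AD k) = (`|2 * c.1 + 1| + `|2 * c.2 + 1| <= 2 * k%:Z).
Proof.
rewrite in_AD /center /=.
have half (i : int) : i%:~R + 2%:R^-1 = (2 * i + 1)%:~R / 2%:R :> rat.
  by rewrite rmorphD rmorphM /=; field.
rewrite !half !normrM !(ger0_norm (_ : 0 <= 2%:R^-1)) // -mulrDl ler_pdivrMr //.
by rewrite -!intr_norm -rmorphD /= (_ : k%:R * 2 = (2 * k%:Z)%:~R) ?ler_int // intrM mulrC.
Qed.

Variables (k a b : nat).
Hypotheses (a_gt0 : (0 < a)%N) (a_le : (a <= k)%N) (b_le : (b <= k)%N).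
Hypothesis ab_le : (a + b <= k.+1)%N.

Let R := truncate (AD k) (- a%:Z) (- b%:Z).

Lemma in_truncated (c : cell) : (c \in R) =
  [&& `|2 * c.1 + 1| + `|2 * c.2 + 1| <= 2 * k%:Z, - a%:Z <= c.1 & - b%:Z <= c.2].
Proof. by rewrite in_fset inE /= in_AD_int. Qed.

Definition height_pos (c : R) : nat * nat :=
  (absz ((fsval c).1 + a%:Z), absz ((fsval c).2 + b%:Z)).

Lemma height_pos_inj : injective height_pos.
Proof.
move=> c d [] h1 h2; apply: val_inj => /=; have := fsvalP c; have := fsvalP d.
move: (fsval c) (fsval d) h1 h2 => [c1 c2] [d1 d2] /=.
rewrite !in_truncated /= => h1 h2 /and3P[_ h3 h4] /and3P[_ h5 h6].
by congr pair; lia.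
Qed.

Lemma height_posP z : reflect (exists c, height_pos c = z) (diamond_cell k a b z).
Proof.
case: z => z1 z2.
have zE : diamond_cell k a b (z1, z2) = ((z1%:Z - a%:Z, z2%:Z - b%:Z) \in R).
  rewrite in_truncated /diamond_cell /col_lo /col_hi /=.
  by case: ifP => h; apply/idP/idP; lia.
rewrite zE; apply: (iffP idP) => [h|[c [<- <-]]].
  by exists [` h]; rewrite /height_pos /=; congr pair; lia.
have := fsvalP c; move: (fsval c) => [c1 c2] /= h; move: (h); rewrite !in_truncated /= => h'.
by lia.
Qed.

Lemma M_truncated : (M R)%:R =
  front_det b (k + a - b).+1 (nseq (k + 1 + b - a) false) :> rat.
Proof.
rewrite -(@card_diamond_matchings k a b _ _ R (fun c d => adjacent (fsval c) (fsval d)) height_pos) //.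
- exact: (leq_trans a_le).
- exact: height_pos_inj.
- exact: height_posP.
move=> c d; rewrite /adjacent /grid_adj /height_pos /=.
have := fsvalP c; have := fsvalP d; move: (fsval c) (fsval d) => [c1 c2] [d1 d2].
by rewrite !in_truncated /=; lia.
Qed.

End TilingCount.

(** * Ballot numbers, Chebyshev polynomials and moments *)

Fixpoint ballot (k h : nat) : nat :=
  match k with
  | 0 => h == 0
  | k1.+1 => ballot k1 h.+1 + (if h is h1.+1 then ballot k1 h1 else 0)
  end.

Lemma ballot_gt k h : k < h -> ballot k h = 0.
Proof.
elim: k h => [|k IH] [|h] //= kh; rewrite !IH //; lia.
Qed.

Lemma ballot_diag k : ballot k k = 1.
Proof. by elim: k => //= k IH; rewrite ballot_gt. Qed.

Local Open Scope ring_scope.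

(* The coefficient of x^i in the h-th Chebyshev polynomial of the second kind
   in x/2 when s = -1, in the h-th Fibonacci polynomial when s = 1. *)
Fixpoint cheb (s : rat) (h i : nat) : rat :=
  match h with
  | 0 => (i == 0%N)%:R
  | 1 => (i == 1%N)%:R
  | (h1.+1 as h2).+1 => (if i is i1.+1 then cheb s h2 i1 else 0) + s * cheb s h1 i
  end.

Lemma chebSS s h i :
  cheb s h.+2 i = (if i is i1.+1 then cheb s h.+1 i1 else 0) + s * cheb s h i.
Proof. by []. Qed.

Arguments cheb : simpl never.

Lemma cheb_gt s h i : (h < i)%N -> cheb s h i = 0.
Proof.
elim/nat_ind2: h i => [||h IH1 IH2] i hi; first by case: i hi.
  by case: i hi => [|[]].
rewrite chebSS IH1 ?mulr0 ?addr0; last by lia.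
by case: i hi => // i hi; rewrite IH2 //; lia.
Qed.

Lemma cheb_diag s h : cheb s h h = 1.
Proof.
elim/nat_ind2: h => [//|//|h _ IH].
by rewrite chebSS IH cheb_gt ?mulr0 ?addr0.
Qed.

Lemma cheb_odd s h i : odd (h + i)%N -> cheb s h i = 0.
Proof.
elim/nat_ind2: h i => [||h IH1 IH2] i hi; first by case: i hi.
  by case: i hi => [|[|i]].
rewrite chebSS IH1 ?mulr0 ?addr0; last by lia.
by case: i hi => // i hi; rewrite IH2 //; lia.
Qed.

(** The coefficients of F_h(x) = i^(-h) U_h(ix). *)
Lemma cheb_sign h i d : h = (i + 2 * d)%N -> cheb 1 h i = (-1) ^+ d * cheb (-1) h i.
Proof.
elim/nat_ind2: h i d => [||h IH1 IH2] i d hi.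
- by rewrite (_ : d = 0)%N ?expr0 ?mul1r //; lia.
- by rewrite (_ : d = 0)%N ?expr0 ?mul1r //; lia.
rewrite !chebSS mul1r mulrDr; congr (_ + _).
  case: i hi => [|i] hi; first by rewrite mulr0.
  by apply: IH2; move: hi; rewrite addSn => -[].
case: d hi => [|d] hi; first by rewrite !cheb_gt ?mulr0 //; move: hi; rewrite addn0 => <-.
have hd : h = (i + 2 * d)%N by move: hi; rewrite mulnS !addnS => -[].
by rewrite (IH1 _ d) // exprS; ring.
Qed.

(** The functional with moments [F], evaluated at the h-th polynomial. *)
Definition cheb_apply s h (F : nat -> rat) : rat := \sum_(i < h.+1) cheb s h i * F i.

Lemma cheb_applySS s h F :
  cheb_apply s h.+2 F = cheb_apply s h.+1 (fun i => F i.+1) + s * cheb_apply s h F.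
Proof.
rewrite /cheb_apply; under eq_bigr do rewrite chebSS mulrDl.
rewrite big_split /= big_ord_recl /= mul0r add0r; congr (_ + _).
rewrite !big_ord_recr /= (@cheb_gt s h h.+1) // (@cheb_gt s h h.+2) // !(mulr0, mul0r, addr0).
rewrite mulrDr !mulr_sumr mulrA; congr (_ + _).
by apply: eq_bigr => i _; rewrite mulrA.
Qed.

(** The relation x U_h = U_(h+1) + U_(h-1) matches the recursion of [ballot], which counts walks
    from height [h] to 0; both sides are mu (x^k U_h). *)
Lemma cheb_ballot k h : cheb_apply (-1) h (fun i => (ballot (k + i)%N 0)%:R) = (ballot k h)%:R.
Proof.
elim/nat_ind2: h k => [k|k|h IH1 IH2 k].
- by rewrite /cheb_apply big_ord_recl big_ord0 mul1r addn0 addr0.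
- by rewrite /cheb_apply !big_ord_recl big_ord0 mul0r mul1r add0r addr0 /= addn1 /= addn0.
rewrite cheb_applySS IH1.
under [cheb_apply _ _ _]eq_bigr do rewrite addnS -addSn.
rewrite [X in X + _](IH2 k.+1) /= natrD; ring.
Qed.

(** The right side is mu (F_c U_h). As F_(c+2) = x F_(c+1) + F_c, and x U_h = U_(h+1) + U_(h-1), it
    obeys the recurrence of [wcoef]. *)
Lemma wcoef_ballot c h : (wcoef c.+1 h.+1)%:R = cheb_apply 1 c (fun i => (ballot i h)%:R).
Proof.
elim/nat_ind2: c h => [h|h|c IH1 IH2 h].
- by rewrite /cheb_apply big_ord_recl big_ord0 mul1r addr0; case: h.
- by rewrite /cheb_apply !big_ord_recl big_ord0 mul0r mul1r add0r addr0 /=; case: h => [|[|[]]].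
rewrite cheb_applySS mul1r -IH1 wcoefSS natrD; congr (_ + _).
rewrite /cheb_apply; under eq_bigr do rewrite /= natrD mulrDr.
rewrite big_split /= -/(cheb_apply 1 c.+1 (fun i => (ballot i h.+1)%:R)) -IH2 natrD addrC.
congr (_ + _); case: h => [|h]; first by rewrite big1 // => i _; rewrite mulr0.
by rewrite -/(cheb_apply 1 c.+1 (fun i => (ballot i h)%:R)) -IH2.
Qed.

Lemma sum_double n (F : nat -> rat) :
  \sum_(i < n.*2) F i = \sum_(i < n) (F (2 * i)%N + F (2 * i).+1).
Proof.
elim: n => [|n IH]; first by rewrite !big_ord0.
by rewrite doubleS !big_ord_recr /= IH -addrA mul2n.
Qed.

Section Parity.
Variable e : nat.
Hypothesis e_le1 : (e <= 1)%N.

Lemma cheb_apply_parity s l n F : (l < n)%N ->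
  cheb_apply s (2 * l + e) F = \sum_(j < n) cheb s (2 * l + e) (2 * j + e) * F (2 * j + e)%N.
Proof.
move=> ln; rewrite /cheb_apply.
rewrite (big_ord_widen n.*2 (fun i => cheb s (2 * l + e) i * F i)); last by lia.
have out i : (if (i < (2 * l + e).+1)%N then cheb s (2 * l + e) i * F i else 0) =
    cheb s (2 * l + e) i * F i.
  by rewrite ltnS; case: leqP => // h; rewrite cheb_gt ?mul0r.
rewrite big_mkcond /=; under eq_bigr do rewrite out.
rewrite (sum_double n (fun i => cheb s (2 * l + e) i * F i)); apply: eq_bigr => j _.
case: e e_le1 => [|[|//]] _.
  by rewrite !addn0 (@cheb_odd s _ (2 * j).+1) ?mul0r ?addr0 //; lia.
by rewrite !addn1 (@cheb_odd s _ (2 * j)%N) ?mul0r ?add0r //; lia.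
Qed.

Definition moment k : rat := (ballot (2 * (k + e)) 0)%:R.

Lemma sum_cheb_moment i l n : (l < n)%N ->
  \sum_(j < n) cheb (-1) (2 * l + e) (2 * j + e) * moment (i + j) =
  (ballot (2 * i + e) (2 * l + e))%:R.
Proof.
move=> ln; rewrite -cheb_ballot (cheb_apply_parity _ _ ln).
by apply: eq_bigr => j _; rewrite /moment; congr (_ * (ballot _ _)%:R); lia.
Qed.

Lemma wcoef_sum_ballot c i n : (c < n)%N -> (wcoef (2 * c + e).+1 (2 * i + e).+1)%:R =
  \sum_(j < n) cheb 1 (2 * c + e) (2 * j + e) * (ballot (2 * j + e) (2 * i + e))%:R.
Proof. by move=> cn; rewrite wcoef_ballot (cheb_apply_parity _ _ cn). Qed.

Lemma cheb_mirror l j :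
  cheb 1 (2 * l + e) (2 * j + e) = (-1) ^+ (l + j) * cheb (-1) (2 * l + e) (2 * j + e).
Proof.
case: (leqP j l) => h; last by rewrite !cheb_gt ?mulr0 //; lia.
rewrite (@cheb_sign _ _ (l - j)%N); last by lia.
rewrite -signr_odd -[in RHS]signr_odd.
by have -> : odd (l - j) = odd (l + j) by rewrite oddB // oddD.
Qed.

Lemma cheb_matrix_det s n :
  \det (\matrix_(i < n, j < n) cheb s (2 * i + e) (2 * j + e)) = 1.
Proof.
rewrite det_trig; last by apply/is_trig_mxP => i j ij; rewrite !mxE cheb_gt //; lia.
by rewrite big1 // => i _; rewrite mxE cheb_diag.
Qed.

(** By orthogonality the coefficients of the U_h bring the Hankel matrix to unitriangular form. *)
Lemma hankel_det n : \det (\matrix_(i < n, j < n) moment (i + j)) = 1.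
Proof.
set H := \matrix_(_, _) _; pose C := \matrix_(i < n, j < n) cheb (-1) (2 * i + e) (2 * j + e).
rewrite -[LHS]mulr1 -[X in _ * X](cheb_matrix_det (-1) n) -/C -(det_tr C) -det_mulmx.
transitivity (\det (\matrix_(i < n, j < n) (ballot (2 * i + e) (2 * j + e))%:R : 'M[rat]_n)); last first.
  rewrite det_trig; last by apply/is_trig_mxP => i j ij; rewrite !mxE ballot_gt //; lia.
  by rewrite big1 // => i _; rewrite mxE ballot_diag.
congr (\det _); apply/matrixP => i j; rewrite !mxE -(sum_cheb_moment i (ltn_ord j)).
by apply: eq_bigr => k _; rewrite !mxE mulrC.
Qed.

Section Mirror.
Variables (m n : nat).

Definition stacked : 'M[rat]_(m + n) := \matrix_(i, j)
  match split i with
  | inl i1 => (-1) ^+ (i1 + j) * moment (i1 + j)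
  | inr i2 => moment (i2 + j)
  end.

Definition tail_matrix : 'M[rat]_n :=
  \matrix_(i, l) (wcoef (2 * (m + l) + e).+1 (2 * i + e).+1)%:R.

(** Multiplied by the unitriangular coefficient matrix of the F_h, the upper rows of [stacked]
    become unitriangular followed by zeros, by orthogonality for the mirrored functional. The lower
    right block is then [tail_matrix] up to the coefficient matrix of the U_h. *)
Lemma det_tail_stacked : \det tail_matrix = \det stacked.
Proof.
pose W : 'M[rat]_(m + n) := \matrix_(j, l) cheb 1 (2 * l + e) (2 * j + e).
have dW : \det W = 1.
  rewrite -det_tr -[RHS](cheb_matrix_det 1 (m + n)); congr (\det _).
  by apply/matrixP => i j; rewrite !mxE.
pose X : 'M[rat]_n := \matrix_(i, l) \sum_(j < m + n) moment (i + j) * cheb 1 (2 * (m + l) + e) (2 * j + e).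
pose C := \matrix_(i < n, j < n) cheb (-1) (2 * i + e) (2 * j + e).
have -> : tail_matrix = C *m X.
  apply/matrixP => i l; rewrite !mxE (@wcoef_sum_ballot _ _ (m + n)) ?ltn_add2l //.
  under [RHS]eq_bigr do rewrite !mxE mulr_sumr.
  rewrite exchange_big /=; apply: eq_bigr => j _.
  rewrite -(sum_cheb_moment j (ltn_ord i)) mulr_sumr; apply: eq_bigr => k _.
  by rewrite (addnC k) mulrC mulrA.
rewrite det_mulmx cheb_matrix_det mul1r.
pose Tl : 'M[rat]_m := \matrix_(i, l) ((-1) ^+ (i + l) * (ballot (2 * i + e) (2 * l + e))%:R).
(* The signs of [cheb_mirror] turn the mirrored moments paired with F_(2l+e) into the pairing of
   x^(2i+e) with U_(2l+e) under mu. *)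
have alt i l : (l < m + n)%N -> \sum_(j < m + n) (-1) ^+ (i + j) * moment (i + j) *
    cheb 1 (2 * l + e) (2 * j + e) = (-1) ^+ (i + l) * (ballot (2 * i + e) (2 * l + e))%:R.
  move=> lmn; rewrite -(sum_cheb_moment i lmn) mulr_sumr; apply: eq_bigr => j _.
  rewrite cheb_mirror !exprD.
  have sq : (-1) ^+ j * (-1) ^+ j = 1 :> rat by rewrite -exprD -signr_odd addnn odd_double.
  transitivity ((-1) ^+ j * (-1) ^+ j * ((-1) ^+ i * (-1) ^+ l *
    (cheb (-1) (2 * l + e) (2 * j + e) * moment (i + j)))); first by ring.
  by rewrite sq mul1r.
have E : stacked *m W = block_mx Tl 0
    (\matrix_(i, l) \sum_(j < m + n) moment (i + j) * cheb 1 (2 * l + e) (2 * j + e)) X.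
  apply/matrixP => i l; rewrite !mxE; case: (splitP i) => i1 ii; rewrite !mxE.
    transitivity (\sum_(j < m + n) (-1) ^+ (i1 + j) * moment (i1 + j) * cheb 1 (2 * l + e) (2 * j + e)).
      apply: eq_bigr => j _; rewrite !mxE; congr (_ * _).
      case: splitP => i3 ii3; last by have := ltn_ord i1; lia.
      by have -> : (i3 = i1 :> nat) by rewrite -ii3 ii.
    rewrite alt //; case: (splitP l) => l1 ll; rewrite !mxE ll //.
    by rewrite ballot_gt ?mulr0 //; have := ltn_ord i1; lia.
  rewrite -[RHS](_ : \sum_(j < m + n) moment (i1 + j) * cheb 1 (2 * l + e) (2 * j + e) = _).
    apply: eq_bigr => j _; rewrite !mxE; congr (_ * _).
    case: splitP => i3 ii3; first by have := ltn_ord i3; lia.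
    by have -> : (i3 = i1 :> nat) by apply: (@addnI m); rewrite -ii3 ii.
  by case: (splitP l) => l1 ll; rewrite !mxE ll.
rewrite -[RHS]mulr1 -dW -det_mulmx E det_lblock [\det Tl](_ : _ = 1) ?mul1r //.
rewrite det_trig; last by apply/is_trig_mxP => i j ij; rewrite !mxE ballot_gt ?mulr0 //; lia.
rewrite big1 // => i _; rewrite mxE ballot_diag mulr1.
by rewrite -signr_odd addnn odd_double.
Qed.
End Mirror.
End Parity.

(** * Separation of the even and the odd columns *)

Section ParitySplit.
Variables (e m n : nat).
Hypotheses (nm : (n <= m)%N) (mn : (m <= n.+1)%N).

Definition interleave_nat (x : 'I_(m + n)) : nat :=
  match split x with inl b => (2 * b)%N | inr b => (2 * b).+1 end.

Lemma interleave_lt x : (interleave_nat x < m + n)%N.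
Proof. by rewrite /interleave_nat; case: splitP => b _; have := ltn_ord b; lia. Qed.

Definition interleave x : 'I_(m + n) := Ordinal (interleave_lt x).

Lemma interleave_inj : injective interleave.
Proof.
move=> x y /(congr1 val) /=; rewrite /interleave_nat.
by case: splitP => b hb; case: splitP => c hc h; apply: val_inj => /=; lia.
Qed.

Definition even_moments k : 'M[rat]_k := \matrix_(i, j) moment e (i + 2 * j).
Definition odd_moments k : 'M[rat]_k := \matrix_(i, j) moment e (i + (2 * j).+1).

(** The sign (-1)^(i+j) is a row sign times a column sign. Once the row signs are factored out,
    upper and lower rows agree on even columns and are opposite on odd ones. Absolute values spare
    the sign of the column permutation. *)
Lemma norm_det_stacked :
  `|\det (stacked e m n)| = 2%:R ^+ n * `|\det (even_moments m)| * `|\det (odd_moments n)|.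
Proof.
pose G := col_perm (perm interleave_inj) (stacked e m n).
have -> : `|\det (stacked e m n)| = `|\det G|.
  by rewrite /G col_permE det_mulmx det_perm normrM normrX normrN1 expr1n mulr1.
pose A := even_moments m.
pose B : 'M[rat]_(m, n) := \matrix_(i, j) moment e (i + (2 * j).+1).
pose P : 'M[rat]_(n, m) := \matrix_(i, j) (i == j :> nat)%:R.
pose S : 'M[rat]_m := diag_mx (\row_i (-1) ^+ i).
have PE k (X : 'M[rat]_(m, k)) (i : 'I_n) j (im : (i < m)%N) : (P *m X) i j = X (Ordinal im) j.
  rewrite mxE (bigD1 (Ordinal im)) //= mxE eqxx mul1r big1 ?addr0 // => l.
  by rewrite mxE -val_eqE /= eq_sym => /negbTE->; rewrite mul0r.
have sgn (i j : nat) : (-1) ^+ (i + 2 * j) = (-1) ^+ i :> rat.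
  by rewrite -signr_odd oddD oddM addbF signr_odd.
have GE : G = block_mx S 0 0 1%:M *m block_mx A (- B) (P *m A) (P *m B).
  rewrite mulmx_block !mul0mx !mul1mx !addr0 !add0r.
  apply/matrixP => i x; rewrite !mxE permE.
  case: (splitP i) => i1 ii; rewrite !mxE /= /interleave_nat; case: splitP => b hb.
  - rewrite mul_diag_mx !mxE sgn //.
  - by rewrite mul_diag_mx !mxE addnS exprS sgn !mulN1r mulNr mulrN.
  - have im : (i1 < m)%N by apply: leq_trans nm.
    by rewrite (PE _ _ _ _ im) mxE.
  - have im : (i1 < m)%N by apply: leq_trans nm.
    by rewrite (PE _ _ _ _ im) mxE.
have dS : `|\det S| = 1.
  rewrite det_diag normr_prod big1 // => i _.
  by rewrite mxE normrX normrN1 expr1n.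
(* Subtracting the first [n] upper rows from the lower ones cancels the even columns and doubles the
   odd ones. *)
have E : block_mx 1%:M 0 (- P) 1%:M *m block_mx A (- B) (P *m A) (P *m B) =
    block_mx A (- B) 0 (2%:R *: odd_moments n).
  have PB : P *m B = odd_moments n.
    apply/matrixP => i j; have im : (i < m)%N by apply: leq_trans nm.
    by rewrite (PE _ _ _ _ im) !mxE.
  rewrite mulmx_block !mul0mx !mul1mx !addr0 !mulNmx mulmxN opprK addNr PB.
  by rewrite scaler_nat mulr2n.
rewrite GE det_mulmx det_ublock det1 mulr1 normrM dS mul1r.
have -> : \det (block_mx A (- B) (P *m A) (P *m B)) =
    \det (block_mx 1%:M 0 (- P) 1%:M *m block_mx A (- B) (P *m A) (P *m B)).
  by rewrite det_mulmx det_lblock !det1 !mul1r.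
by rewrite E det_ublock detZ !normrM normrX normr_nat mulrCA mulrA.
Qed.

End ParitySplit.

(** * Catalan determinants in closed form *)

Lemma fact_neq0 n : (n`!)%:R != 0 :> rat.
Proof. by rewrite pnatr_eq0 -lt0n fact_gt0. Qed.

Lemma factS_rat n : (n.+1`!)%:R = n.+1%:R * (n`!)%:R :> rat.
Proof. by rewrite factS natrM. Qed.

Lemma ballot_fact h j : (ballot (h + 2 * j) h)%:R =
  h.+1%:R * ((h + 2 * j)`!)%:R / ((j`!)%:R * ((h + j).+1`!)%:R) :> rat.
Proof.
move: {2}(h + 2 * j)%N (erefl (h + 2 * j)%N) => k; elim: k h j => [|k IH] h j E.
  have -> : h = 0%N by lia.
  by have -> : j = 0%N by lia.
have nz (m : nat) : m.+1%:R != 0 :> rat by rewrite pnatr_eq0.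
rewrite E /= natrD factS_rat; case: h E => [|h] E.
  case: j E => [//|j] E; have kE : k = (1 + 2 * j)%N by lia.
  have := IH 1%N j (esym kE); rewrite -kE => ->.
  rewrite addr0 add0n add1n !(factS_rat j.+1) !(factS_rat j).
  have := nz j; have := nz j.+1; have := fact_neq0 j.
  have -> : k.+1%:R = 2 * j.+1%:R :> rat by rewrite -natrM; congr _%:R; lia.
  move: (j`!%:R) (k`!%:R) (j.+1%:R) (j.+2%:R) => x y u v xn vn un; field.
  by rewrite vn xn un.
case: j E => [|j] E.
  have kE : k = (h + 2 * 0)%N by lia.
  rewrite ballot_gt ?add0r; last by lia.
  have := IH h 0%N (esym kE); rewrite -kE => ->.
  have -> : k = h by lia.
  rewrite !addn0 !(factS_rat h.+1) !(factS_rat h) [(0`!)%:R](_ : _ = 1) // !mul1r.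
  have := nz h; have := nz h.+1; have := fact_neq0 h.
  move: (h`!%:R) (h.+1%:R) (h.+2%:R) => x u v xn vn un; field.
  by rewrite vn xn un.
have := IH h.+2 j; rewrite (_ : h.+2 + 2 * j = k)%N => [->//|]; last by lia.
have := IH h j.+1; rewrite (_ : h + 2 * j.+1 = k)%N => [->//|]; last by lia.
rewrite !(addSn, addnS) !(factS_rat (h + j).+2) !(factS_rat (h + j).+1) !(factS_rat j).
have -> : k.+1%:R = (h + j).+2%:R + j.+1%:R :> rat by rewrite -natrD; congr _%:R; lia.
have -> : h.+3%:R = h.+1%:R + 2 :> rat by rewrite -natrD; congr _%:R; lia.
have -> : h.+2%:R = h.+1%:R + 1 :> rat by rewrite natr1.
have := nz (h + j).+1; have := nz (h + j).+2; have := nz j; have := fact_neq0 j.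
have := fact_neq0 (h + j).+1.
have -> : (h + j).+3%:R = h.+1%:R + j.+1%:R + 1 :> rat.
  by rewrite -natrD natr1; congr _%:R; lia.
have -> : (h + j).+2%:R = h.+1%:R + j.+1%:R :> rat by rewrite -natrD; congr _%:R; lia.
move: (k`!%:R) ((h + j).+1`!%:R) (j`!%:R) (j.+1%:R) (h.+1%:R) => x y z u v yn zn un v1 v2.
by field; rewrite yn zn un v1 v2.
Qed.

Definition catalan N : rat := ((2 * N)`!)%:R / ((N`!)%:R * (N.+1`!)%:R).

Lemma catalanS N : catalan N.+1 = catalan N * (4 * N%:R + 2) / (N%:R + 2).
Proof.
have N0 : 0 <= N%:R :> rat by exact: ler0n.
rewrite /catalan mulnS !addSn add0n !(factS_rat N.+1) !(factS_rat N) (factS_rat (2 * N).+1) (factS_rat (2 * N)).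
rewrite -!natr1 natrM; have := fact_neq0 N; have := fact_neq0 (2 * N).
move: (N`!%:R) ((2 * N)`!%:R) => x y yn xn; field; rewrite xn /=.
by rewrite !lt0r_neq0 //; lra.
Qed.

Lemma momentE e k : moment e k = catalan (k + e).
Proof. by rewrite /moment -[(2 * _)%N]add0n ballot_fact mul1r. Qed.

Section CatalanDeterminant.
Variable n : nat.

Definition cat_weight x : rat := ((2 * x)`!)%:R / ((x`!)%:R * ((x + n)`!)%:R).

(** Cat_(i+x) / Cat_x is the product of (4(x+t)+2) / (x+t+2) over t < i. The second product here
    completes the denominators to (x+2)...(x+n) for every [i], and [cat_weight] absorbs this common
    denominator. *)
Definition cat_poly i : {poly rat} :=
  \prod_(0 <= t < i) (4%:P * ('X + t%:R%:P) + 2%:P) * \prod_(i <= t < n.-1) ('X + t.+2%:R%:P).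

Lemma size_prod_linear (s : seq nat) (F : nat -> {poly rat}) : (forall t, size (F t) <= 2)%N ->
  (size (\prod_(t <- s) F t)%R <= (size s).+1)%N.
Proof.
move=> F2; elim: s => [|t s IH]; first by rewrite big_nil size_poly1.
by rewrite big_cons; apply: leq_trans (size_polyMleq _ _) _; have := F2 t; move: IH => /=; lia.
Qed.

Lemma size_cat_poly i : (i < n)%N -> (size (cat_poly i) <= n)%N.
Proof.
move=> lt_in; apply: leq_trans (size_polyMleq _ _) _.
have XD c : (size ('X + c%:P : {poly rat})%R <= 2)%N by rewrite size_XaddC.
have h1 : (size (\prod_(0 <= t < i) (4%:P * ('X + t%:R%:P) + 2%:P : {poly rat}))%R <= i.+1)%N.
  rewrite -[X in (_ <= X.+1)%N](size_iota 0) -[X in iota _ X]subn0.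
  apply: size_prod_linear => t; apply: leq_trans (size_polyD _ _) _.
  by rewrite geq_max size_polyC (leq_trans (leq_b1 _)) // mul_polyC (leq_trans (size_scale_leq _ _)).
have h2 : (size (\prod_(i <= t < n.-1) ('X + t.+2%:R%:P : {poly rat}))%R <= (n.-1 - i).+1)%N.
  by rewrite -[X in (_ <= X.+1)%N](size_iota i); apply: size_prod_linear.
lia.
Qed.

Lemma fact_prod x k : ((x + k).+1`!)%:R = (x.+1`!)%:R * \prod_(0 <= t < k) (x%:R + t.+2%:R) :> rat.
Proof.
elim: k => [|k IH]; first by rewrite addn0 big_nil mulr1.
rewrite big_nat_recr //= mulrA -IH addnS factS_rat mulrC -natrD; congr (_ * _%:R); lia.
Qed.

Lemma catalan_poly i x : (i < n)%N -> catalan (i + x) = cat_weight x * (cat_poly i).[x%:R].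
Proof.
have pos t : x%:R + t.+2%:R != 0 :> rat by rewrite -natrD pnatr_eq0 addnS.
rewrite /cat_poly hornerM !horner_prod.
have -> : \prod_(0 <= t < i) (4%:P * ('X + t%:R%:P) + 2%:P).[x%:R] =
    \prod_(0 <= t < i) (4 * (x%:R + t%:R) + 2) :> rat.
  by apply: eq_bigr => t _; rewrite !hornerE.
have -> : \prod_(i <= t < n.-1) ('X + t.+2%:R%:P).[x%:R] =
    \prod_(i <= t < n.-1) (x%:R + t.+2%:R) :> rat.
  by apply: eq_bigr => t _; rewrite !hornerE.
elim: i => [|i IH] lt_in.
  rewrite big_nil mul1r add0n /cat_weight /catalan.
  have -> : (x + n = (x + n.-1).+1)%N by lia.
  rewrite fact_prod.
  have p0 : \prod_(0 <= t < n.-1) (x%:R + t.+2%:R) != 0 :> rat.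
    by rewrite prodf_seq_neq0; apply/allP => t _; exact: pos.
  have := fact_neq0 x; have := fact_neq0 x.+1; move: p0.
  move: (\prod_(_ <= _ < _) _) (x`!%:R) (x.+1`!%:R) => u v w *.
  by field; apply/and3P; split.
rewrite addSn catalanS IH; last exact: ltnW.
have := pos i; have -> : (i + x)%:R + 2 = x%:R + i.+2%:R :> rat by rewrite -!natrD; congr _%:R; lia.
rewrite (@big_ltn _ _ _ i) /=; last by lia.
rewrite big_nat_recr //= natrD.
move=> _; field; have x0 := ler0n rat x; have i0 := ler0n rat i.
by apply: lt0r_neq0; lra.
Qed.

Lemma catalan_matrixE (x : nat -> nat) :
  \matrix_(i < n, j < n) catalan (i + x j) =
  (\matrix_(i < n, d < n) (cat_poly i)`_d) *m Vandermonde n (\row_(j < n) (x j)%:R)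
    *m diag_mx (\row_j cat_weight (x j)).
Proof.
apply/matrixP => i j; rewrite mul_mx_diag !mxE catalan_poly // mulrC; congr (_ * _).
rewrite (horner_coef_wide _ (size_cat_poly (ltn_ord i))).
by apply: eq_bigr => d _; rewrite !mxE.
Qed.

Definition vdm (x : nat -> nat) : rat :=
  \prod_(i < n) \prod_(j < n | (i < j)%N) ((x j)%:R - (x i)%:R).

(** Up to the weights the matrix is a coefficient matrix, the same for all [x], times a Vandermonde
    matrix. The determinant of the former is eliminated by comparison with the identity, where the
    Catalan determinant is the Hankel determinant 1. *)
Lemma det_catalan (x : nat -> nat) :
  \det (\matrix_(i < n, j < n) catalan (i + x j)) * (vdm id * \prod_(j < n) cat_weight j) =
  vdm x * \prod_(j < n) cat_weight (x j).
Proof.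
have dE (y : nat -> nat) : \det (\matrix_(i < n, j < n) catalan (i + y j)) =
    \det (\matrix_(i < n, d < n) (cat_poly i)`_d) * (vdm y * \prod_(j < n) cat_weight (y j)).
  rewrite catalan_matrixE !det_mulmx det_diag det_Vandermonde mulrA; congr (_ * _ * _).
    by apply: eq_bigr => i _; apply: eq_bigr => j _; rewrite !mxE.
  by apply: eq_bigr => j _; rewrite mxE.
have d1 : \det (\matrix_(i < n, j < n) catalan (i + id j)) = 1.
  rewrite -[RHS](@hankel_det 0 isT n); congr (\det _); apply/matrixP => i j.
  by rewrite !mxE momentE addn0.
by rewrite dE mulrAC -dE d1 mul1r.
Qed.

End CatalanDeterminant.

Lemma vdm_affine n c : vdm n (fun j => 2 * j + c)%N = 2%:R ^+ 'C(n, 2) * vdm n id.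
Proof.
rewrite /vdm.
have -> : 2%:R ^+ 'C(n, 2) = \prod_(i < n) \prod_(j < n | (i < j)%N) 2%:R :> rat.
  rewrite (exchange_big_dep xpredT) //= -bin2_sum big_mkord expr_sum.
  apply: eq_bigr => j _; rewrite -[RHS](big_ord_widen n (fun=> 2%:R)) 1?ltnW //.
  by rewrite prodr_const card_ord.
rewrite -big_split; apply: eq_bigr => i _; rewrite -big_split; apply: eq_bigr => j _ /=.
by rewrite !natrD; ring.
Qed.

Lemma vdm_id_neq0 n : vdm n id != 0.
Proof.
apply/prodf_neq0 => i _; apply/prodf_neq0 => j ij.
by rewrite subr_eq0 eqr_nat gtn_eqF.
Qed.

Lemma prod_double n (F : nat -> rat) :
  \prod_(i < n.*2) F i = \prod_(i < n) (F (2 * i)%N * F (2 * i).+1).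
Proof.
elim: n => [|n IH]; first by rewrite !big_ord0.
by rewrite doubleS !big_ord_recr /= IH -mulrA mul2n.
Qed.

(** The factorials j! and (j+n)! for j < n are together 0!, ..., (2n-1)!. Regrouped as (2j)!
    (2j+1)!, they cancel the numerators. *)
Lemma prod_cat_weight n : \prod_(j < n) cat_weight n j = \prod_(j < n) ((2 * j).+1`!)%:R^-1.
Proof.
rewrite /cat_weight big_split /= !prodfV.
have -> : \prod_(j < n) ((j`!)%:R * ((j + n)`!)%:R) =
    \prod_(j < n) (((2 * j)`!)%:R * ((2 * j).+1`!)%:R) :> rat.
  rewrite -(prod_double n (fun j => (j`!)%:R)) -addnn big_split_ord /= -big_split /=.
  by apply: eq_bigr => j _; rewrite addnC.
rewrite big_split /= invfM mulrA divff ?mul1r //.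
by apply/prodf_neq0 => j _; exact: fact_neq0.
Qed.

Definition catalan_det c n : rat := 2%:R ^+ 'C(n, 2) *
  \prod_(j < n) (((2 * (2 * j + c))`!)%:R * ((2 * j).+1`!)%:R
                 / (((2 * j + c)`!)%:R * ((2 * j + c + n)`!)%:R)).

Lemma det_catalan_affine c n :
  \det (\matrix_(i < n, j < n) catalan (i + (2 * j + c))) = catalan_det c n.
Proof.
have := det_catalan n (fun j => 2 * j + c)%N.
rewrite vdm_affine prod_cat_weight => E; rewrite /catalan_det.
have p0 : \prod_(j < n) ((2 * j).+1`!)%:R != 0 :> rat.
  by apply/prodf_neq0 => j _; exact: fact_neq0.
have := vdm_id_neq0 n; move: E; rewrite prodfV.
have -> : \prod_(j < n) (((2 * (2 * j + c))`!)%:R * ((2 * j).+1`!)%:R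
                 / (((2 * j + c)`!)%:R * ((2 * j + c + n)`!)%:R)) =
    \prod_(j < n) cat_weight n (2 * j + c) * \prod_(j < n) ((2 * j).+1`!)%:R :> rat.
  by rewrite -big_split; apply: eq_bigr => j _; rewrite /cat_weight /= mulrAC.
move: (\det _) (vdm n id) (\prod_(j < n) ((2 * j).+1`!)%:R) p0 => d v w w0 E v0.
by apply: (mulIf (mulf_neq0 v0 (invr_neq0 w0))); rewrite E; field.
Qed.

Lemma catalan_det_ge0 c n : 0 <= catalan_det c n.
Proof.
rewrite mulr_ge0 ?exprn_ge0 ?ler0n //; apply: prodr_ge0 => j _.
by rewrite divr_ge0 ?mulr_ge0 ?ler0n.
Qed.

Lemma det_even_moments e n : \det (even_moments e n) = catalan_det e n.
Proof.
rewrite -det_catalan_affine; congr (\det _); apply/matrixP => i j; rewrite !mxE momentE.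
by congr catalan; lia.
Qed.

Lemma det_odd_moments e n : \det (odd_moments e n) = catalan_det e.+1 n.
Proof.
rewrite -det_catalan_affine; congr (\det _); apply/matrixP => i j; rewrite !mxE momentE.
by congr catalan; lia.
Qed.

(** * Evaluation of the tiling counts *)

Lemma M_TAD_det (k a b e : nat) : (e <= 1)%N -> (0 < a <= k)%N -> (b <= k)%N -> (a + b + e = k.+1)%N ->
  (M (truncate (AD k) (- a%:Z) (- b%:Z)))%:R =
  \det (\matrix_(i < b, j < b) (wcoef (2 * (a + j) + e).+1 (2 * i + e).+1)%:R) :> rat.
Proof.
move=> e1 /andP[a0 ak] bk ab; rewrite M_truncated //; last by lia.
rewrite -front_det_nseq //; congr front_det; last congr nseq; lia.
Qed.

(** The sign lost in [norm_det_stacked] is recovered from the nonnegativity of both sides. *)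
Lemma M_TAD_catalan (k m n e : nat) : (e <= 1)%N -> (0 < m <= k)%N -> (n <= m <= n.+1)%N ->
  (m + n + e = k.+1)%N ->
  (M (truncate (AD k) (- m%:Z) (- n%:Z)))%:R =
  2%:R ^+ n * catalan_det e m * catalan_det e.+1 n :> rat.
Proof.
move=> e1 mk /andP[nm mn] E; have det_eq := @M_TAD_det k m n e e1 mk _ E.
rewrite -[LHS]ger0_norm ?ler0n // det_eq; last by lia.
rewrite -/(tail_matrix e m n) (det_tail_stacked e1) norm_det_stacked //.
by rewrite det_even_moments det_odd_moments !ger0_norm ?catalan_det_ge0.
Qed.

(** The quotients (2j+1)! / (2j)! leave the factors of a double factorial. *)
Lemma catalan_det0 n : catalan_det 0 n =
  2%:R ^+ 'C(n, 2) * (\prod_(j < n) (2 * j).+1%:R *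
    \prod_(j < n) (((4 * j)`!)%:R / ((n + 2 * j)`!)%:R)).
Proof.
rewrite /catalan_det -big_split; congr (_ * _); apply: eq_bigr => j _ /=.
rewrite addn0 (_ : 2 * (2 * j) = 4 * j)%N; last by lia.
rewrite (addnC n) factS_rat; have := fact_neq0 (2 * j); have := fact_neq0 (2 * j + n).
by move: (_`!%:R) (_`!%:R) (_`!%:R) (_.+1%:R) => x y z t *; field; apply/andP.
Qed.

Lemma catalan_det1 n : catalan_det 1 n =
  2%:R ^+ 'C(n, 2) * \prod_(j < n) (((4 * j + 2)`!)%:R / ((n + 2 * j + 1)`!)%:R).
Proof.
rewrite /catalan_det; congr (_ * _); apply: eq_bigr => j _ /=.
rewrite (_ : 2 * (2 * j + 1) = 4 * j + 2)%N; last by lia.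
rewrite (_ : 2 * j + 1 + n = n + 2 * j + 1)%N; last by lia.
rewrite addn1; have := fact_neq0 (2 * j).+1; have := fact_neq0 (n + 2 * j + 1).
by move: (_`!%:R) (_`!%:R) (_`!%:R) => x y z *; field; apply/andP.
Qed.

(** The extra power of 2 comes from (4j+4)! (2j+1)! / (2j+2)! = 2 (4j+3)!. *)
Lemma catalan_det2 n : catalan_det 2 n =
  2%:R ^+ ('C(n, 2) + n) * \prod_(j < n) (((4 * j + 3)`!)%:R / ((n + 2 * j + 2)`!)%:R).
Proof.
rewrite /catalan_det exprD -mulrA -[in 2%:R ^+ n](card_ord n) -prodr_const -big_split /=.
congr (_ * _); apply: eq_bigr => j _ /=.
rewrite (_ : 2 * (2 * j + 2) = (4 * j + 3).+1)%N; last by lia.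
rewrite (_ : 2 * j + 2 + n = n + 2 * j + 2)%N; last by lia.
rewrite (_ : 2 * j + 2 = (2 * j).+2)%N; last by lia.
rewrite (factS_rat (4 * j + 3)) (factS_rat (2 * j).+1).
rewrite (_ : (4 * j + 3).+1%:R = 2 * (2 * j).+2%:R :> rat); last by rewrite -natrM; congr _%:R; lia.
have := fact_neq0 (2 * j).+1; have := fact_neq0 (n + 2 * j + 2).
have : (2 * j).+2%:R != 0 :> rat by rewrite pnatr_eq0.
move: ((4 * j + 3)`!%:R) ((2 * j).+1`!%:R) ((n + 2 * j + 2)`!%:R) ((2 * j).+2%:R) => x y z t *.
by field; apply/and3P.
Qed.

Lemma dfact_prod n : (dfact (2 * n - 1))%:R = \prod_(j < n) (2 * j).+1%:R :> rat.
Proof.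
elim: n => [|[|n] IH]; first by rewrite big_ord0.
  by rewrite big_ord_recl big_ord0.
rewrite (_ : 2 * n.+2 - 1 = (2 * n.+1 - 1).+2)%N; last by lia.
rewrite big_ord_recr [dfact _.+2]/= natrM mulrC IH; congr (_ * _%:R) => /=; lia.
Qed.

Lemma bin2_double n : ('C(n, 2) + 'C(n, 2) + n = n ^ 2)%N.
Proof.
elim: n => // n IH; rewrite binS bin1; move: IH; rewrite !expnS !expn0; nia.
Qed.

(** The factors for i = 2j and i = 2j + 1 interleave to one product over i < 2n, whose term at i = 0
    is 1/n!. *)
Lemma prod_double_fact n :
  \prod_(j < n) (((4 * j)`!)%:R / ((n + 2 * j)`!)%:R) *
  \prod_(j < n) (((4 * j + 2)`!)%:R / ((n + 2 * j + 1)`!)%:R) =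
  (n`!)%:R^-1 * \prod_(1 <= i < 2 * n) (((2 * i)`!)%:R / ((n + i)`!)%:R) :> rat.
Proof.
case: n => [|n]; first by rewrite !big_ord0 big_geq // mulr1 invr1.
set m := n.+1.
transitivity (\prod_(0 <= i < 2 * m) (((2 * i)`!)%:R / ((m + i)`!)%:R) : rat).
  rewrite big_mkord mul2n (prod_double m (fun i => ((2 * i)`!)%:R / ((m + i)`!)%:R)) -big_split.
  apply: eq_bigr => j _ /=; congr (_ / _ * (_ / _)); congr (_`!%:R); lia.
by rewrite big_ltn ?muln0 ?addn0 ?div1r.
Qed.

Theorem theorem3p2 (n : nat) (n_gt0 : (0 < n)%N) :
  [/\ (M (TAD (2 * n - 1)))%:R =
        2%:R ^+ (n ^ 2) * ((dfact (2 * n - 1))%:R / (n`!)%:R)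
        * \prod_(1 <= i < 2 * n) (((2 * i)`!)%:R / ((n + i)`!)%:R) :> rat,
      (M (TAD (2 * n)))%:R =
        2%:R ^+ (n * (n + 1))
        * \prod_(0 <= i < n)
            (((4 * i + 2)`! * (4 * i + 3)`!)%:R
             / ((n + 2 * i + 1)`! * (n + 2 * i + 2)`!)%:R) :> rat,
      (M (TAD' (2 * n - 1)))%:R =
        2%:R ^+ (n ^ 2 - 1)
        * \prod_(0 <= i < n)
            (((4 * i + 2)`!)%:R / ((n + 2 * i + 1)`!)%:R)
        * \prod_(0 <= i < n - 1)
            (((4 * i + 3)`!)%:R / ((n + 2 * i + 1)`!)%:R) :> rat
    & (M (TAD' (2 * n)))%:R =
        2%:R ^+ (n * (n + 1)) * ((dfact (2 * n + 1))%:R / ((n + 1)`!)%:R)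
        * \prod_(0 <= i < n)
            (((4 * i + 2)`! * (4 * i + 4)`!)%:R
             / ((n + 2 * i + 1)`! * (n + 2 * i + 3)`!)%:R) :> rat].
Proof.
(* The four families are the cases (m, n, e) = (n, n, 0), (n, n, 1), (n, n-1, 1) and (n+1, n, 0) of
   [M_TAD_catalan]. *)
split.
- rewrite TAD_odd // (@M_TAD_catalan _ n n 0) //; try lia.
  rewrite catalan_det0 catalan_det1 -bin2_double !exprD dfact_prod.
  rewrite -[RHS]mulrA -[_ / _ * _]mulrA -prod_double_fact; ring.
- rewrite TAD_even (@M_TAD_catalan _ n n 1) //; try lia.
  rewrite catalan_det1 catalan_det2 [(n * (n + 1))%N](_ : _ = 'C(n, 2) + 'C(n, 2) + n + n)%N; last first.
    by rewrite bin2_double; nia.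
  have -> : \prod_(0 <= i < n) (((4 * i + 2)`! * (4 * i + 3)`!)%:R
      / ((n + 2 * i + 1)`! * (n + 2 * i + 2)`!)%:R) =
    \prod_(j < n) (((4 * j + 2)`!)%:R / ((n + 2 * j + 1)`!)%:R) *
    \prod_(j < n) (((4 * j + 3)`!)%:R / ((n + 2 * j + 2)`!)%:R) :> rat.
    by rewrite big_mkord -big_split; apply: eq_bigr => j _; rewrite /= !natrM -mulf_div.
  by rewrite !exprD; ring.
- rewrite TAD'_odd // (_ : - n%:Z + 1 = - (n - 1)%N%:Z); last by lia.
  rewrite (@M_TAD_catalan _ n (n - 1) 1) //; try lia.
  rewrite catalan_det1 catalan_det2 !big_mkord.
  have -> : (n ^ 2 - 1 = (n - 1) + 'C(n, 2) + ('C(n - 1, 2) + (n - 1)))%N.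
    case: n n_gt0 => // n _; rewrite [(n.+1 - 1)%N]subn1 /= binS bin1; have := bin2_double n; rewrite !expnS !expn0; nia.
  rewrite (eq_bigr (fun j : 'I_(n - 1) => ((4 * j + 3)`!)%:R / ((n + 2 * j + 1)`!)%:R)) => [|j _].
    by rewrite !exprD; ring.
  by congr (_ / (_`!)%:R); lia.
- rewrite TAD'_even (_ : - n%:Z - 1 = - (n.+1)%:Z); last by lia.
  rewrite (@M_TAD_catalan _ n.+1 n 0) //; try lia.
  rewrite catalan_det0 catalan_det1 [(n * (n + 1))%N](_ : _ = n + 'C(n.+1, 2) + 'C(n, 2))%N; last first.
    by have := bin2_double n; rewrite binS bin1 expnS expn1; nia.
  rewrite (_ : 2 * n + 1 = 2 * n.+1 - 1)%N; last by lia.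
  (* The factor j = 0 is the separate 1/(n+1)! of the formula; the others are shifted by one. *)
  rewrite dfact_prod addn1 [\prod_(j < n.+1) (_ / _)]big_ord_recl !muln0 addn0 div1r.
  have -> : \prod_(i < n) (((4 * lift ord0 i)`!)%:R / ((n.+1 + 2 * lift ord0 i)`!)%:R) =
    \prod_(j < n) (((4 * j + 4)`!)%:R / ((n + 2 * j + 3)`!)%:R) :> rat.
    apply: eq_bigr => j _; rewrite lift0.
    by rewrite (_ : 4 * j.+1 = 4 * j + 4)%N 1?(_ : n.+1 + 2 * j.+1 = n + 2 * j + 3)%N //; lia.
  have -> : \prod_(0 <= i < n) (((4 * i + 2)`! * (4 * i + 4)`!)%:R
      / ((n + 2 * i + 1)`! * (n + 2 * i + 3)`!)%:R) =
    \prod_(j < n) (((4 * j + 2)`!)%:R / ((n + 2 * j + 1)`!)%:R) *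
    \prod_(j < n) (((4 * j + 4)`!)%:R / ((n + 2 * j + 3)`!)%:R) :> rat.
    by rewrite big_mkord -big_split; apply: eq_bigr => j _; rewrite /= !natrM -mulf_div.
  by rewrite !exprD; ring.
Qed.
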